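(* Let $K$ be an infinite compact subset of $\mathbb R^d$. Then a typical measure $\mu\in\mathcal P(K)$ satisfies $\underline D_\mu(1)=0$ and $\overline D_\mu(1)\in[\overline{\dim}_{B,{\rm conv}}(K),\overline{\dim}_{B,{\rm conv,max}}(K)]$. Moreover, if $[a,b]$ is any interval such that a typical measure $\mu\in\mathcal P(K)$ satisfies $\overline D_\mu(1)\in[a,b]$, then $a\le\overline{\dim}_{B,{\rm conv}}(K)$ and $b\ge\overline{\dim}_{B,{\rm conv,max}}(K)$.
   Context: $\mathcal P(K)$ is the set of Borel probability measures on $K$ with the weak topology; ''a typical measure satisfies P'' means the set of measures satisfying P contains a dense $G_\delta$ subset of $\mathcal P(K)$. $B(x,r)$ is the open ball. $\underline D_\mu(1)=\liminf_{r\to0}\frac{\int_K\log\mu(B(x,r))\,d\mu(x)}{\log r}$ and $\overline D_\mu(1)$ is the corresponding $\limsup$. $\mathbf P_r(E)$ is the largest number of pairwise disjoint balls of radius $r$ centered in $E$. The convex upper box dimension is $\overline{\dim}_{B,{\rm conv}}(K)=\inf_{N\ge1}\inf_{x_1,\dots,x_N\in K}\inf_{\rho>0}\inf_{p_i>0,\sum_ip_i=1}\limsup_{r\to0}\frac{\sum_{i=1}^Np_i\log\mathbf P_r(K\cap B(x_i,\rho))}{-\log r}$, and the maximal convex upper box dimension is $\overline{\dim}_{B,{\rm conv,max}}(K)=\sup_{y\in K,\rho>0}\overline{\dim}_{B,{\rm conv}}(K\cap B(y,\rho))$. *)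

(* Defs.v *)
From HB Require Import structures.
From mathcomp Require Import all_boot all_order all_algebra.
From mathcomp Require Import all_classical all_reals all_analysis.
Set Implicit Arguments. Unset Strict Implicit. Unset Printing Implicit Defensive.
Import Order.TTheory GRing.Theory Num.Theory.
Import numFieldNormedType.Exports.
Local Open Scope classical_set_scope.
Local Open Scope ring_scope.

Section Defs.
Variables (R : realType) (d : nat).

Definition Rd := 'rV[R]_d.

Definition BorelRd := g_sigma_algebraType (@open Rd).

Definition edist (x y : Rd) : R := Num.sqrt (\sum_(i < d) (x ord0 i - y ord0 i) ^+ 2).
Definition eball (x : Rd) (r : R) : set Rd := [set y | edist x y < r].

(* P(K): Borel probability measures on R^d concentrated on K
   (identified with Borel probability measures on K). *)
Definition PK (K : set Rd) : set (probability BorelRd R) :=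
  [set mu | mu (K : set BorelRd) = 1%E].

Definition intK (K : set Rd) (mu : probability BorelRd R) (f : Rd -> R) : \bar R :=
  (\int[mu]_(x in (K : set BorelRd)) (f x)%:E)%E.

Definition weak_nbhd (K : set Rd) (mu : probability BorelRd R)
    (fs : seq (Rd -> R)) (eps : R) : set (probability BorelRd R) :=
  [set nu | PK K nu /\
     forall f, f \in fs -> (`| intK K nu f - intK K mu f | < eps%:E)%E].

Definition cont_fams (K : set Rd) (fs : seq (Rd -> R)) :=
  forall f, f \in fs -> {within K, continuous f}.

Definition weak_open (K : set Rd) (U : set (probability BorelRd R)) :=
  U `<=` PK K /\
  forall mu, U mu -> exists fs eps, cont_fams K fs /\ 0 < eps /\ weak_nbhd K mu fs eps `<=` U.

Definition weak_dense (K : set Rd) (A : set (probability BorelRd R)) :=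
  A `<=` PK K /\
  forall U, weak_open K U -> U !=set0 -> (A `&` U) !=set0.

Definition typical (K : set Rd) (P : probability BorelRd R -> Prop) :=
  exists G : nat -> set (probability BorelRd R),
    (forall n, weak_open K (G n)) /\
    weak_dense K (\bigcap_n G n) /\
    (forall mu, (\bigcap_n G n) mu -> P mu).

Definition liminf0 (g : R -> \bar R) : \bar R :=
  ereal_sup [set ereal_inf (g @` [set r | 0 < r < delta]) | delta in [set delta : R | 0 < delta]].
Definition limsup0 (g : R -> \bar R) : \bar R :=
  ereal_inf [set ereal_sup (g @` [set r | 0 < r < delta]) | delta in [set delta : R | 0 < delta]].

Definition elog (x : \bar R) : \bar R :=
  match x with
  | r%:E => if 0 < r then (ln r)%:E else -oo%E
  | +oo%E => +oo%E
  | -oo%E => -oo%E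
  end.

Definition Dquot (K : set Rd) (mu : probability BorelRd R) (r : R) : \bar R :=
  ((\int[mu]_(x in (K : set BorelRd)) elog (mu (eball x r : set BorelRd)))
     * ((ln r)^-1)%:E)%E.

Definition lowerD1 (K : set Rd) (mu : probability BorelRd R) : \bar R :=
  liminf0 (Dquot K mu).
Definition upperD1 (K : set Rd) (mu : probability BorelRd R) : \bar R :=
  limsup0 (Dquot K mu).

Definition packing (E : set Rd) (r : R) : \bar R :=
  ereal_sup [set (n%:R)%:E | n in [set n : nat | exists x : 'I_n -> Rd,
     (forall i, E (x i)) /\
     (forall i j, i != j -> eball (x i) r `&` eball (x j) r = set0)]].

Definition conv_ubox (E : set Rd) : \bar R :=
  ereal_inf [set v | exists (N : nat) (x : 'I_N -> Rd) (rho : R) (p : 'I_N -> R),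
     [/\ (1 <= N)%N, (forall i, E (x i)), 0 < rho,
         (forall i, 0 < p i) /\ \sum_(i < N) p i = 1 &
         v = limsup0 (fun r =>
           ((\sum_(i < N) (p i)%:E * elog (packing (E `&` eball (x i) rho) r))
             * ((- ln r)^-1)%:E)%E)]].

Definition conv_ubox_max (K : set Rd) : \bar R :=
  ereal_sup [set v | exists (y : Rd) (rho : R),
     [/\ K y, 0 < rho & v = conv_ubox (K `&` eball y rho)]].

End Defs.

(* Main.v *)
Require Import Defs.
From HB Require Import structures.
From mathcomp Require Import all_boot all_order all_algebra.
From mathcomp Require Import all_classical all_reals all_analysis.
From mathcomp Require Import measurable_realfun ring lra.
Import Order.TTheory GRing.Theory Num.Theory.
Import numFieldNormedType.Exports.
Import Defs.
Set Implicit Arguments.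
Unset Strict Implicit.
Unset Printing Implicit Defensive.
Local Open Scope classical_set_scope.
Local Open Scope ring_scope.

(** [Dquot K mu r] is an entropy, minus the integral of log mu(B(x,r)), divided by -log r. A piece
    of K covered by n balls of radius r/2 contributes at most its mass times log n, plus 1
    ([integral_covered]). Conversely, an upper bound on the mass of the balls B(x,r) bounds the
    entropy from below ([entropy_lower]). All arguments take place near finitely supported measures:
    by [exists_basic_nbhd], every nonempty weakly open set contains a [basic_nbhd], the measures
    that give more than p_i - e to each ball B(x_i,e), for finitely many atoms x_i in K with weights
    p_i of sum 1.

    Lower dimension: fix a scale r first. All measures close enough to one with N atoms have entropy
    at most N + 2 at that scale, and this is negligible against -log r ([dense_lower_entropy]).

    Upper estimates: measures near the sum of the p_i delta_{x_i} have, at all small scales at once,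
    entropy at most the sum of the p_i log P_r(K ∩ B(x_i,rho)) plus a small multiple of -log r
    ([open_upper_bound]). A family of points nearly optimal for [conv_ubox K] thus yields an open
    set on which [upperD1] is hardly larger, which forces a <= [conv_ubox K]. Replacing each atom
    x_i of an arbitrary discrete measure by a family nearly optimal in K ∩ B(x_i,e) gives such open
    sets densely, with the bound [conv_ubox_max K] ([dense_upper_bound]).

    Lower estimates: spread every atom uniformly over a maximal r-packing of its neighbourhood. The
    entropy at scale r becomes at least the sum of the p_i log P_r minus a constant, and
    [conv_ubox], an infimum over all families, bounds the growth of that sum for a suitable small r
    ([dense_upper_entropy]). Carried out among the measures giving mass more than s to a ball
    B(y,rho), with s close to 1, this produces values close to [conv_ubox (K ∩ B(y,rho))], whence b
    >= [conv_ubox_max K].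

    Countably many such conditions are combined by the Baire property of P(K), proved directly in
    [baire_weak]: discrete laws in nested basic neighbourhoods are realized on [0,1] by simple
    functions that converge off a null set ([couple_step]), and the law of the limit lies in all the
    neighbourhoods ([exists_limit_law]). *)

(** * Euclidean distance and balls *)

Section EuclideanDistance.
Variables (R : realType) (d : nat).
Implicit Types x y z : Rd R d.

(** Expand the nonnegative sum of the (B a_i - A b_i)^2, where A and B are the two norms, and divide
    by 2AB; a vanishing norm is treated apart. *)
Lemma cauchy_schwarz_sum (I : finType) (a b : I -> R) :
  \sum_i a i * b i <=
    Num.sqrt (\sum_i a i ^+ 2) * Num.sqrt (\sum_i b i ^+ 2).
Proof.
set A2 := \sum_i a i ^+ 2; set B2 := \sum_i b i ^+ 2.
have A20 : 0 <= A2 by apply: sumr_ge0 => i _; exact: sqr_ge0.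
have B20 : 0 <= B2 by apply: sumr_ge0 => i _; exact: sqr_ge0.
set A := Num.sqrt A2; set B := Num.sqrt B2.
have AE : A ^+ 2 = A2 by exact: sqr_sqrtr.
have BE : B ^+ 2 = B2 by exact: sqr_sqrtr.
have A0 : 0 <= A by exact: sqrtr_ge0.
have B0 : 0 <= B by exact: sqrtr_ge0.
have zero_sq (c : I -> R) i : \sum_i c i ^+ 2 = 0 -> c i = 0.
  move=> /eqP; rewrite psumr_eq0; last by move=> *; exact: sqr_ge0.
  by move=> /allP /(_ i (mem_index_enum _)) /=; rewrite sqrf_eq0 => /eqP.
have [A00|A0n] := eqVneq A 0.
  rewrite A00 mul0r big1// => i _; rewrite (zero_sq a) ?mul0r//.
  by rewrite -/A2 -AE A00 expr0n.
have [B00|B0n] := eqVneq B 0.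
  rewrite B00 mulr0 big1// => i _; rewrite (zero_sq b) ?mulr0//.
  by rewrite -/B2 -BE B00 expr0n.
have AB0 : 0 < A * B by rewrite mulr_gt0// lt_neqAle eq_sym ?A0n ?B0n.
have : 0 <= \sum_i (B * a i - A * b i) ^+ 2.
  by apply: sumr_ge0 => i _; exact: sqr_ge0.
have -> : \sum_i (B * a i - A * b i) ^+ 2 =
    B ^+ 2 * A2 + A ^+ 2 * B2 - 2 * (A * B) * \sum_i a i * b i.
  rewrite 3!mulr_sumr -big_split /= -sumrB.
  by apply: eq_bigr => i _; ring.
rewrite -AE -BE => h; rewrite -(ler_pM2l AB0).
by move: h; set S := \sum_i _; nra.
Qed.

Lemma edist_ge0 x y : 0 <= edist x y.
Proof. exact: sqrtr_ge0. Qed.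

Lemma edistxx x : edist x x = 0.
Proof. by rewrite /edist big1 ?sqrtr0// => i _; rewrite subrr expr0n. Qed.

Lemma edist_sym x y : edist x y = edist y x.
Proof.
by rewrite /edist; congr Num.sqrt; apply: eq_bigr => i _; rewrite -sqrrN opprB.
Qed.

Lemma edist_triangle y x z : edist x z <= edist x y + edist y z.
Proof.
rewrite -(@ler_pXn2r _ 2)// ?nnegrE ?addr_ge0 ?edist_ge0//.
rewrite sqrrD !sqr_sqrtr ?sumr_ge0//; try by move=> *; exact: sqr_ge0.
have := cauchy_schwarz_sum (fun i => x ord0 i - y ord0 i)
                           (fun i => y ord0 i - z ord0 i).
rewrite -/(edist x y) -/(edist y z) => cs.
rewrite [leLHS](_ : _ = \sum_(i < d) (x ord0 i - y ord0 i) ^+ 2 +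
   (\sum_(i < d) (x ord0 i - y ord0 i) * (y ord0 i - z ord0 i)) *+ 2 +
   \sum_(i < d) (y ord0 i - z ord0 i) ^+ 2).
  by rewrite lerD2r lerD2l ler_wMn2r.
rewrite -sumrMnl -!big_split /=.
by apply: eq_bigr => i _; rewrite -mulr_natr; ring.
Qed.

Lemma coord_le_edist x y i : `|x ord0 i - y ord0 i| <= edist x y.
Proof.
rewrite -sqrtr_sqr ler_sqrt; last by apply: sumr_ge0 => *; exact: sqr_ge0.
by rewrite (bigD1 i)//= lerDl sumr_ge0// => *; exact: sqr_ge0.
Qed.

(** The crude factor [d], in place of its square root, suffices: only orders of magnitude matter
    below. *)
Lemma edist_le_coord x y e : 0 <= e ->
  (forall i, `|x ord0 i - y ord0 i| <= e) -> edist x y <= d%:R * e.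
Proof.
move=> e0 h; have de0 : 0 <= d%:R * e by rewrite mulr_ge0.
rewrite -[leRHS]ger0_norm// -sqrtr_sqr ler_sqrt ?sqr_ge0//.
apply: (@le_trans _ _ (\sum_(i < d) e ^+ 2)).
  apply: ler_sum => i _; rewrite -(real_normK (num_real _)).
  by rewrite ler_pXn2r ?nnegrE.
rewrite sumr_const card_ord -[leLHS]mulr_natl exprMn ler_wpM2r ?sqr_ge0//.
by rewrite -natrX ler_nat; case: d => // n; rewrite expnS expn1 leq_pmull.
Qed.

(** Were the centres closer than 2r, their midpoint would lie in both balls. This turns packings
    into separated sets. *)
Lemma disjoint_eballs x y r :
  eball x r `&` eball y r = set0 -> 2 * r <= edist x y.
Proof.
move=> h; rewrite leNgt; apply/negP => lt2r.
pose z : Rd R d := \row_i ((x ord0 i + y ord0 i) / 2).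
have half (u v : Rd R d) : (forall i, u ord0 i - z ord0 i =
    2^-1 * (u ord0 i - v ord0 i)) -> edist u z = 2^-1 * edist u v.
  move=> e; rewrite /edist -[2^-1 in RHS]ger0_norm ?invr_ge0// -sqrtr_sqr.
  rewrite -sqrtrM ?sqr_ge0// mulr_sumr; congr Num.sqrt.
  by apply: eq_bigr => i _; rewrite e exprMn.
suff : (eball x r `&` eball y r) z by rewrite h.
split; rewrite /eball /=.
  by rewrite (half _ y) => [|i]; [lra|rewrite mxE; field].
by rewrite (half _ x) => [|i]; [rewrite edist_sym; lra|rewrite mxE; field].
Qed.

Lemma eball_center x r : 0 < r -> eball x r x.
Proof. by move=> r0; rewrite /eball /= edistxx. Qed.

Lemma le_eball x y r s : edist x y + r <= s -> eball y r `<=` eball x s.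
Proof.
move=> h z; rewrite /eball /= => yz.
by apply: le_lt_trans (edist_triangle y _ _) _; rewrite (lt_le_trans _ h)// ltrD2l.
Qed.

(** The ambient topology is that of the maximum norm, which is comparable to the Euclidean one. *)
Lemma nbhs_eball x (A : set (Rd R d)) :
  nbhs x A <-> exists2 r, 0 < r & eball x r `<=` A.
Proof.
split=> [/nbhs_ballP[e /= e0 eA]|[r r0 rA]].
  exists e => // y xy; apply: eA; split => // i j; rewrite ord1.
  exact: le_lt_trans (coord_le_edist _ _ _) xy.
(* [d.+1] rather than [d]: the divisor is nonzero in dimension 0, and [d * (r / d.+1)] is strictly
   below [r]. *)
apply/nbhs_ballP; exists (r / (d.+1)%:R) => /=; first by rewrite divr_gt0.
move=> y [_ xy]; apply: rA; rewrite /eball /=.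
apply: (@le_lt_trans _ _ (d%:R * (r / (d.+1)%:R))).
  apply: edist_le_coord; first by rewrite divr_ge0// ltW.
  by move=> i; rewrite ltW//; exact: xy.
by rewrite mulrCA gtr_pMr// ltr_pdivrMr// mul1r ltr_nat.
Qed.

Lemma eball_open x r : open (eball x r).
Proof.
rewrite openE => y; rewrite /eball /= => xy; apply/nbhs_eball.
exists (r - edist x y); first by rewrite subr_gt0.
by apply: le_eball; rewrite addrC subrK.
Qed.

Lemma open_BorelRd (A : set (Rd R d)) : open A -> measurable (A : set (BorelRd R d)).
Proof. by move=> oA; apply: sub_sigma_algebra. Qed.

Lemma eball_measurable x r : measurable (eball x r : set (BorelRd R d)).
Proof. by apply: open_BorelRd; exact: eball_open. Qed.

Lemma compact_BorelRd (K : set (Rd R d)) :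
  compact K -> measurable (K : set (BorelRd R d)).
Proof.
move=> cK; rewrite -[K]setCK; apply: measurableC; apply: open_BorelRd.
by apply: closed_openC; apply: compact_closed => //; exact: norm_hausdorff.
Qed.

Lemma compact_coord_bounded (K : set (Rd R d)) : compact K ->
  exists2 M : R, 0 < M & forall x, K x -> forall i, `|x ord0 i| <= M.
Proof.
move=> /compact_bounded[M [_ hM]]; exists (`|M| + 1); first by rewrite ltr_pwDr.
move=> x Kx i; apply: le_trans (hM (`|M| + 1) _ x Kx).
  by rewrite [leRHS]/Num.norm /= mx_normrE; apply: (le_bigmax _ _ (ord0, i)).
by rewrite (le_lt_trans (ler_norm _))// ltrDl.
Qed.

Lemma compact_eball_cover (K : set (Rd R d)) (rad : Rd R d -> R) :
  compact K -> (forall x, K x -> 0 < rad x) ->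
  exists s : seq (Rd R d), (forall x, x \in s -> K x) /\
    forall y, K y -> exists2 x, x \in s & eball x (rad x) y.
Proof.
rewrite compact_cover => cK rad0.
have [||D DK KD] := cK _ K (fun x => eball x (rad x)).
- by move=> x _; exact: eball_open.
- by move=> x Kx; exists x => //; exact/eball_center/rad0.
exists (finmap.enum_fset D); split; first by move=> x xD; have := DK _ xD; rewrite inE.
by move=> y /KD[x xD xy]; exists x.
Qed.

End EuclideanDistance.

(** * Real-valued masses of probability measures *)

Section Mass.
Context (R : realType) (disp : measure_display) (T : measurableType disp).
Implicit Types (mu nu : probability T R) (A B : set T).

Definition mass mu A : R := fine (mu A).

Lemma massE mu A : measurable A -> mu A = (mass mu A)%:E.
Proof. by move=> mA; rewrite fineK//; exact: fin_num_measure. Qed.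

Lemma mass_ge0 mu A : 0 <= mass mu A.
Proof. exact/fine_ge0/measure_ge0. Qed.

Lemma mass_le mu A B : measurable A -> measurable B -> A `<=` B -> mass mu A <= mass mu B.
Proof.
by move=> mA mB AB; rewrite -lee_fin -!massE//; apply: le_measure => //; rewrite inE.
Qed.

Lemma massT mu : mass mu setT = 1.
Proof. by rewrite /mass probability_setT. Qed.

Lemma mass0 mu : mass mu set0 = 0.
Proof. by rewrite /mass measure0. Qed.

Lemma mass_le1 mu A : measurable A -> mass mu A <= 1.
Proof. by move=> mA; rewrite -(massT mu); apply: mass_le. Qed.

Lemma massU mu A B : measurable A -> measurable B -> A `&` B = set0 ->
  mass mu (A `|` B) = mass mu A + mass mu B.
Proof.
move=> mA mB AB; apply: EFin_inj; rewrite EFinD -!massE//.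
  by rewrite measureU.
exact: measurableU.
Qed.

Lemma mass_setC mu A : measurable A -> mass mu (~` A) = 1 - mass mu A.
Proof.
move=> mA; apply/eqP; rewrite -subr_eq0 opprB addrA -massU ?setvU ?massT ?subrr//.
  exact: measurableC.
by rewrite setICl.
Qed.

(** Bonferroni's inequality: the part of [A] outside [B] weighs at most as much as the complement of
    [B]. *)
Lemma massI_ge mu A B : measurable A -> measurable B ->
  mass mu A + mass mu B - 1 <= mass mu (A `&` B).
Proof.
move=> mA mB; have mAB : measurable (A `&` B) by exact: measurableI.
have mAD : measurable (A `\` B) by exact: measurableD.
have -> : mass mu A = mass mu (A `&` B) + mass mu (A `\` B).
  rewrite -(massU mu mAB mAD); first by rewrite setUIDK.
  by apply/seteqP; split=> // t [[_ ?] []].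
have : mass mu (A `\` B) <= mass mu (~` B).
  by apply: mass_le => //; exact: measurableC.
by rewrite mass_setC//; lra.
Qed.

Lemma mass_bigsetU mu (I : eqType) (s : seq I) (A : I -> set T) :
  (forall i, measurable (A i)) -> (forall i j, i != j -> A i `&` A j = set0) -> uniq s ->
  mass mu (\big[setU/set0]_(i <- s) A i) = \sum_(i <- s) mass mu (A i).
Proof.
move=> mA dA; elim: s => [|i s IH] /=; first by rewrite !big_nil mass0.
move=> /andP[ns us]; rewrite !big_cons massU//; first by rewrite IH.
  exact: bigsetU_measurable.
rewrite big_distrr/= big_seq big1// => j js; apply: dA.
by apply: contraNneq ns => ->.
Qed.

Lemma sum_mass mu (I : finType) (P : pred I) (A : I -> set T) :
  (forall i, measurable (A i)) -> (forall i j, i != j -> A i `&` A j = set0) ->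
  \sum_(i | P i) mass mu (A i) = mass mu (\big[setU/set0]_(i | P i) A i).
Proof.
move=> mA dA; rewrite -[LHS]big_filter -[in RHS]big_filter mass_bigsetU//.
by rewrite filter_uniq// index_enum_uniq.
Qed.

Lemma sum_mass_le mu (I : finType) (P : pred I) (A : I -> set T) B :
  (forall i, measurable (A i)) -> (forall i j, i != j -> A i `&` A j = set0) ->
  measurable B -> (forall i, P i -> A i `<=` B) ->
  \sum_(i | P i) mass mu (A i) <= mass mu B.
Proof.
move=> mA dA mB AB; rewrite sum_mass//; apply: mass_le => //.
  exact: bigsetU_measurable.
by move=> x; rewrite -bigcup_seq_cond => -[i /andP[_ Pi]]; exact: AB.
Qed.

(** Normalization does not change a measure of total mass 1; the point [t] only feeds its default
    Dirac mass. *)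
Lemma probability_of_measure (m : {measure set T -> \bar R}) : T ->
  m setT = 1%E -> exists mu : probability T R, forall A, mu A = m A.
Proof.
move=> t m1; exists (mnormalize m (dirac t)) => A.
by rewrite /= /mnormalize m1 onee_eq0 /= invr1 mule1.
Qed.

End Mass.

(** * Finitely supported measures *)

Section DiscreteMeasure.
Variables (R : realType) (d : nat).

Lemma weighted_dirac_measure (I : Type) (s : seq I) (p : I -> R)
    (x : I -> Rd R d) : (forall i, 0 <= p i) ->
  exists m : {measure set (BorelRd R d) -> \bar R}, forall A : set (BorelRd R d),
    m A = (\sum_(i <- s) p i * (x i \in A)%:R)%:E.
Proof.
move=> p0; elim: s => [|i s [m IH]].
  by exists mzero => A; rewrite big_nil.
exists (measure_add (mscale (NngNum (p0 i)) (dirac (x i : BorelRd R d))) m) => A.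
by rewrite [LHS]measure_addE IH big_cons EFinD.
Qed.

Lemma exists_discrete (I : finType) (p : I -> R) (x : I -> Rd R d) :
  (forall i, 0 <= p i) -> \sum_i p i = 1 ->
  exists mu : probability (BorelRd R d) R,
    forall A, mass mu A = \sum_(i | x i \in A) p i.
Proof.
move=> p0 p1; have [m mE] := weighted_dirac_measure (index_enum I) x p0.
have [|mu muE] := @probability_of_measure _ _ _ m (0 : Rd R d).
  rewrite mE; congr EFin; rewrite -[RHS]p1; apply: eq_bigr => i _.
  by rewrite in_setT mulr1.
exists mu => A; rewrite /mass muE mE [RHS]big_mkcond /=; apply: eq_bigr => i _.
by case: (x i \in A); rewrite /= ?mulr1 ?mulr0.
Qed.

End DiscreteMeasure.

(** * Weak topology and masses of balls *)

Section WeakTopology.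
Variables (R : realType) (d : nat) (K : set (Rd R d)).
Hypothesis cK : compact K.
Local Notation prob := (probability (BorelRd R d) R).
Local Notation meas A := (measurable (A : set (BorelRd R d))).
Implicit Types (mu nu : prob) (U V W : set prob).

Lemma measK : meas K. Proof. exact: compact_BorelRd. Qed.

Lemma PK_massI mu A : PK K mu -> meas A -> mass mu (K `&` A) = mass mu A.
Proof.
move=> muK mA; have mK := measK.
have K1 : mass mu K = 1 by rewrite /mass muK.
have KA0 : mass mu (A `\` K) = 0.
  apply/eqP; rewrite eq_le mass_ge0 andbT -(subrr 1) -{2}K1 -mass_setC//.
  apply: mass_le; [exact: measurableD|exact: measurableC|].
  by move=> x [].
have AE : A = (K `&` A) `|` (A `\` K).
  apply/seteqP; split=> [x Ax|x [[]|[]]//].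
  by have [Kx|Kx] := pselect (K x); [left|right].
rewrite [in RHS]AE massU ?KA0 ?addr0//.
- exact: measurableI.
- exact: measurableD.
- by apply/seteqP; split=> // x [[? _] []].
Qed.

Lemma within_continuous_measurable (f : Rd R d -> R) :
  {within K, continuous f} -> measurable_fun (K : set (BorelRd R d)) f.
Proof.
move=> /continuousP cf; apply: (measurability _ (RGenOpens.measurableE R)).
move=> _ [_ [a [b ->] <-]].
have oA := cf _ (@interval_open _ (BRight a) (BLeft b) isT isT).
have [V oV VD] := (open_subspaceP _ _).1 oA.
by rewrite setIC -VD; apply: measurableI; [exact: open_BorelRd|exact: measK].
Qed.

Lemma lipschitz_continuous (f : Rd R d -> R) (c : R) :
  (forall x y, `|f x - f y| <= c * edist x y) -> continuous f.
Proof.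
move=> lf x; have ? : Filter (nbhs x) by exact: nbhs_filter.
apply/cvgrPdist_lt => e e0; apply/nbhs_eball.
exists (e / (`|c| + 1)); first by rewrite divr_gt0// ltr_pwDr.
move=> y; rewrite /eball /= ltr_pdivlMr ?ltr_pwDr// => xy.
apply: le_lt_trans (lf _ _) _; apply: le_lt_trans xy.
rewrite mulrC; apply: ler_wpM2l; first exact: edist_ge0.
have := ler_norm c; lra.
Qed.

Lemma weak_open_sub U : weak_open K U -> U `<=` PK K.
Proof. by case. Qed.

Lemma weak_openI U V : weak_open K U -> weak_open K V -> weak_open K (U `&` V).
Proof.
move=> [UP oU] [VP oV]; split=> [mu [/UP]//|mu [/oU[fs [e [cfs [e0 fsU]]]]]].
move=> /oV[gs [e' [cgs [e'0 gsV]]]].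
exists (fs ++ gs), (Num.min e e'); split.
  by move=> f; rewrite mem_cat => /orP[/cfs|/cgs].
split; first by rewrite lt_min e0.
move=> nu [nuK h]; split.
  apply: fsU; split=> // f ffs; apply: lt_le_trans (h _ _) _.
    by rewrite mem_cat ffs.
  by rewrite lee_fin ge_min lexx.
apply: gsV; split=> // f ffs; apply: lt_le_trans (h _ _) _.
  by rewrite mem_cat ffs orbT.
by rewrite lee_fin ge_min lexx orbT.
Qed.

Lemma weak_openT : weak_open K (PK K).
Proof. by split=> // mu muK; exists [::], 1; split=> //; split=> // nu []. Qed.

Lemma weak_open_forall (I : finType) (U : I -> set prob) :
  (forall i, weak_open K (U i)) -> weak_open K [set nu | PK K nu /\ forall i, U i nu].
Proof.
move=> oU.
have : forall s : seq I, weak_open K [set nu | PK K nu /\ forall i, i \in s -> U i nu].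
  elim=> [|i s IH].
    rewrite [X in weak_open _ X](_ : _ = PK K); first exact: weak_openT.
    by apply/seteqP; split=> [nu []|nu ?]//; split.
  have := weak_openI (oU i) IH; congr weak_open; apply/seteqP; split=> nu /=.
    move=> [Ui [nuK h]]; split=> // j; rewrite inE => /predU1P[->//|]; exact: h.
  move=> [nuK h]; split; first by apply: h; rewrite mem_head.
  by split=> // j js; apply: h; rewrite inE js orbT.
move=> /(_ (index_enum I)); congr weak_open; apply/seteqP; split=> nu /= [nuK h];
  by split=> // i; apply: h; exact: mem_index_enum.
Qed.

(* plateau function: 1 on the ball of radius [e'], 0 off the ball of radius [e] *)
Definition bump (x : Rd R d) (e e' : R) (y : Rd R d) : R :=
  Num.min 1 (Num.max 0 ((e - edist x y) / (e - e'))).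

Lemma bump_continuous x e e' : e' < e -> continuous (bump x e e').
Proof.
move=> ee'; apply: (@lipschitz_continuous _ (e - e')^-1) => y z.
have e0 : 0 < (e - e')^-1 by rewrite invr_gt0 subr_gt0.
have lip (a b : R) : `|Num.min 1 (Num.max 0 a) - Num.min 1 (Num.max 0 b)| <= `|a - b|.
  by rewrite /Num.min /Num.max; do ![case: ifPn]; rewrite -?leNgt => *;
    rewrite ler_norml; apply/andP; split; 
    have := ler_norm (a - b); have := ler_norm (b - a); rewrite (distrC b); lra.
apply: le_trans (lip _ _) _.
rewrite -mulrBl normrM mulrC (gtr0_norm e0) ler_wpM2l ?(ltW e0)//.
rewrite [X in `|X|](_ : _ = edist x z - edist x y); last by ring.
rewrite ler_norml; apply/andP; split.
  by have := edist_triangle z x y; rewrite (edist_sym z y); lra.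
by have := edist_triangle y x z; lra.
Qed.

Lemma bump_within x e e' : e' < e -> {within K, continuous (bump x e e')}.
Proof. by move=> ee'; exact: (continuous_subspaceT (@bump_continuous x e e' ee')). Qed.

(** [bump] lies between the indicator functions of the two concentric balls. *)
Lemma intK_bump x e e' mu : PK K mu -> e' < e ->
  ((mass mu (eball x e'))%:E <= intK K mu (bump x e e') <=
     (mass mu (eball x e))%:E)%E.
Proof.
move=> muK ee'; have mb r := @eball_measurable R d x r; have mK := measK.
have f0 y : 0 <= bump x e e' y by rewrite /bump le_min ler01 le_max lexx.
have f1 y : bump x e e' y <= 1 by rewrite /bump ge_min lexx.
have mf : measurable_fun (K : set (BorelRd R d)) (fun y => (bump x e e' y)%:E).
  have mf := within_continuous_measurable (@bump_within x _ _ ee').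
  exact/measurable_EFinP.
apply/andP; split.
  rewrite -(PK_massI muK)// -massE; last exact: measurableI.
  rewrite -[leLHS]mul1e -integral_cst; last exact: measurableI.
  apply: (@le_trans _ _
      (\int[mu]_(y in (K `&` eball x e' : set (BorelRd R d))) (bump x e e' y)%:E)%E).
    apply: ge0_le_integral => //; first exact: measurableI.
    - by apply: measurable_funS mf => //; exact: subIsetl.
    - move=> y [_ xy]; rewrite lee_fin /bump le_min lexx /= le_max; apply/orP; right.
      by rewrite ler_pdivlMr ?subr_gt0// mul1r lerD2l lerN2 ltW.
  apply: ge0_subset_integral => //; first exact: measurableI.
  by move=> y _; rewrite lee_fin.
rewrite /intK -(PK_massI muK)// -massE; last exact: measurableI.
rewrite -[leRHS]mul1e -integral_cst; last exact: measurableI.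
rewrite [leRHS]integral_mkcondr; apply: ge0_le_integral => //.
- by move=> y _; rewrite lee_fin.
- apply: measurable_funTS; exact/(measurable_restrictT _ _).1.
move=> y _; rewrite /patch; case: ifPn => [_|]; first by rewrite lee_fin.
rewrite notin_setE /eball /= => /negP; rewrite -leNgt => xy.
rewrite lee_fin /bump ge_min; apply/orP; right; rewrite ge_max lexx/=.
by rewrite pmulr_lle0 ?invr_gt0 ?subr_gt0// subr_le0.
Qed.

(** An open ball is the increasing union of smaller concentric ones, along which the measure is
    continuous. *)
Lemma mass_eball_inner mu x e a : a < mass mu (eball x e) ->
  exists2 e', e' < e & a < mass mu (eball x e').
Proof.
move=> ae; have mb r := @eball_measurable R d x r.
pose F n : set (BorelRd R d) := eball x (e - n.+1%:R^-1).
have FE : \bigcup_n F n = eball x e.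
  apply/seteqP; split=> [y [n _]|y xy].
    apply: le_eball; rewrite edistxx add0r gerDl oppr_le0 invr_ge0 ler0n.
    by [].
  have xy0 : 0 < e - edist x y by rewrite subr_gt0.
  have [N _ /(_ N (leqnn N)) /= h] := near_infty_natSinv_lt (PosNum xy0).
  have {}h : N.+1%:R^-1 < e - edist x y := h.
  by exists N => //; rewrite /F /eball /= ltrBrDl -ltrBrDr.
have cv : mu \o F @ \oo --> mu (\bigcup_n F n).
  apply: nondecreasing_cvg_mu => [n||n m nm].
  - exact: mb.
  - by rewrite FE; exact: mb.
  - apply/subsetPset/le_eball; rewrite edistxx add0r lerD2l lerN2.
    by rewrite lef_pV2 ?posrE ?ltr0n// ler_nat ltnS.
rewrite FE in cv; apply: contrapT => hn; move: ae; apply/negP; rewrite -leNgt.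
rewrite -lee_fin -massE// -(cvg_lim _ cv)//; apply: lime_le.
  by apply/cvg_ex; eexists; exact: cv.
apply: nearW => n /=; rewrite massE ?lee_fin; last exact: mb.
rewrite leNgt; apply/negP => h; apply: hn; exists (e - n.+1%:R^-1) => //.
by rewrite gtrDl oppr_lt0 invr_gt0 ltr0n.
Qed.

(** Lower semicontinuity of the mass of an open ball. Weak neighbourhoods only control continuous
    functions, so a [bump] is inserted between the ball and a smaller one whose mass still exceeds
    [a]. *)
Lemma weak_open_mass_eball a x e :
  weak_open K [set nu | PK K nu /\ a < mass nu (eball x e)].
Proof.
split=> [nu []//|mu [muK /= /mass_eball_inner[e' ee' ae']]].
exists [:: bump x e e'], (mass mu (eball x e') - a); split.
  move=> f; rewrite inE => /eqP ->.
  exact: bump_within.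
split; first by rewrite subr_gt0.
move=> nu [nuK /(_ _ (mem_head _ _)) h]; split=> //=.
have /andP[mu1 mu2] := intK_bump x muK ee'.
have /andP[nu1 nu2] := intK_bump x nuK ee'.
have fin (t : \bar R) b c : (b%:E <= t <= c%:E)%E -> t = (fine t)%:E.
  by case: t => //= /andP[]; rewrite ?leey_eq ?leeNy_eq.
move: mu1 mu2 nu1 nu2 h.
rewrite (fin _ _ _ (intK_bump x muK ee')) (fin _ _ _ (intK_bump x nuK ee')).
rewrite !lee_fin -EFinB abse_EFin lte_fin ltr_norml => ? ? ? ? /andP[]; lra.
Qed.

(** Lower bounds on masses of open balls are weakly open conditions. When the balls are disjoint and
    the weights add up to 1, they also bound these masses from above, up to a multiple of [e]. *)
Definition basic_nbhd (I : finType) (x : I -> Rd R d) (p : I -> R) e : set prob :=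
  [set nu | PK K nu /\ forall i, p i - e < mass nu (eball (x i) e)].

Lemma weak_open_basic (I : finType) (x : I -> Rd R d) (p : I -> R) e :
  weak_open K (basic_nbhd x p e).
Proof.
have := weak_open_forall (fun i => weak_open_mass_eball (p i - e) (x i) e).
congr weak_open; apply/seteqP; split=> nu [nuK h]; split=> // i.
by have [] := h i.
Qed.

End WeakTopology.

(** * Approximation of integrals by finite sums *)

Section DiscreteApproximation.
Variables (R : realType) (d : nat) (K : set (Rd R d)).
Hypothesis cK : compact K.
Local Notation prob := (probability (BorelRd R d) R).
Local Notation meas A := (measurable (A : set (BorelRd R d))).
Implicit Types (mu nu : prob) (U V W : set prob) (A B : set (Rd R d)).

Lemma within_continuous_eball (f : Rd R d -> R) x (e : R) :
  {within K, continuous f} -> K x -> 0 < e ->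
  exists2 r, 0 < r & forall y, K y -> eball x r y -> `|f x - f y| < e.
Proof.
move=> /continuousP cf Kx e0.
have oA := cf _ (@ball_open _ R^o (f x) e).
have [V oV VD] := (open_subspaceP _ _).1 oA.
have : (V `&` K) x.
  by rewrite VD; split=> //; rewrite /= /ball/= subrr normr0.
move=> [Vx _]; have /nbhs_eball[r r0 rV] : nbhs x V by exact: open_nbhs_nbhs.
exists r => // y Ky /rV Vy.
have : (V `&` K) y by [].
by rewrite VD => -[].
Qed.

Section OneFunction.
Variables (f : Rd R d -> R) (M : R).
Hypothesis cf : {within K, continuous f}.
Hypothesis fM : forall x, K x -> `|f x| <= M.

Let integrable_f mu A : meas A -> A `<=` K ->
  mu.-integrable (A : set (BorelRd R d)) (EFin \o (f : BorelRd R d -> R)).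
Proof.
move=> mA AK; apply: measurable_bounded_integrable => //.
- by rewrite (le_lt_trans (probability_le1 _ mA))// ltry.
- exact: measurable_funS (measK cK) AK (within_continuous_measurable cK cf).
- exists M; split; first exact: num_real.
  by move=> N MN x Ax; rewrite /= (le_trans (fM (AK _ Ax)))// ltW.
Qed.

Local Notation int mu A := (Rintegral mu (A : set (BorelRd R d)) (f : BorelRd R d -> R)).

Lemma intK_Rintegral mu : intK K mu f = (int mu K)%:E.
Proof.
rewrite /intK /Rintegral fineK//; apply: integrable_fin_num => //.
  exact: measK.
by apply: integrable_f => //; exact: measK.
Qed.

Lemma Rintegral_near mu A (a e : R) : meas A -> A `<=` K ->
  (forall x, A x -> `|f x - a| <= e) -> `|int mu A - a * mass mu A| <= e * mass mu A.
Proof.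
move=> mA AK h; have cint (c : R) :
    mu.-integrable (A : set (BorelRd R d)) (EFin \o (cst c : BorelRd R d -> R)).
  apply: measurable_bounded_integrable => //.
    by rewrite (le_lt_trans (probability_le1 _ mA))// ltry.
  exists `|c|; split; first exact: num_real.
  by move=> N MN x Ax; rewrite /= ltW.
rewrite /mass -!Rintegral_cst// -(RintegralB mA (integrable_f mu mA AK) (cint a)).
have fa : mu.-integrable (A : set (BorelRd R d))
    (EFin \o ((fun x => f x - a) : BorelRd R d -> R)).
  have := integrableB mA (integrable_f mu mA AK) (cint a).
  by apply: eq_integrable.
apply: le_trans (le_normr_Rintegral mA fa) _.
apply: le_Rintegral => //.
  by have := integrable_norm fa.
exact: cint.

Qed.

(** On a cell [f] is within [e] of a constant; on the rest of [K] it is only bounded by [M], which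
    costs [M] times the mass left over. *)
Lemma Rintegral_cells mu (I : finType) (B : I -> set (Rd R d)) (a : I -> R) (e : R) :
  (forall i, meas (B i)) -> (forall i j, i != j -> B i `&` B j = set0) ->
  (forall i, B i `<=` K) -> PK K mu -> 0 <= e ->
  (forall i x, B i x -> `|f x - a i| <= e) ->
  `|int mu K - \sum_i a i * mass mu (B i)| <= e + M * (1 - \sum_i mass mu (B i)).
Proof.
move=> mB dB BK muK e0 h.
set D := \big[setU/set0]_i B i.
have mD : meas D by exact: bigsetU_measurable.
have DK : D `<=` K by move=> x; rewrite /D -bigcup_seq => -[i _]; exact: BK.
have mK := measK cK.
have K1 : mass mu K = 1 by rewrite /mass muK.
have mKD : meas (K `\` D) by exact: measurableD.
have KE : D `|` (K `\` D) = K by rewrite setDUK.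
have massKD : mass mu (K `\` D) = 1 - \sum_i mass mu (B i).
  by rewrite sum_mass// -/D -K1 -[in mass mu K]KE massU// ?setDIK// addrC addKr.
have intD : int mu D = \sum_i int mu (B i).
  rewrite /D; elim: (index_enum I) (index_enum_uniq I) => [|i s IH] /=.
    by rewrite !big_nil Rintegral_set0.
  move=> /andP[ns us]; rewrite !big_cons -IH// Rintegral_setU//.
  - exact: bigsetU_measurable.
  - apply: integrable_f; first by apply: measurableU => //; exact: bigsetU_measurable.
    by move=> x [/BK//|]; rewrite -bigcup_seq => -[j _]; exact: BK.
  - apply/eqP; rewrite -subset0 => x [Bix]; rewrite -bigcup_seq => -[j js Bjx].
    rewrite -(dB i j); first by split.
    by apply: contraNneq ns => ->.
have -> : int mu K = int mu D + int mu (K `\` D).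
  rewrite -[in LHS]KE Rintegral_setU//; last by rewrite disj_set2E setDIK.
  by apply: integrable_f; rewrite KE.
rewrite intD addrAC -sumrB; apply: le_trans (ler_normD _ _) _; apply: lerD.
  apply: le_trans (ler_norm_sum _ _ _) _.
  apply: (@le_trans _ _ (\sum_i e * mass mu (B i))).
    by apply: ler_sum => i _; apply: Rintegral_near => //; exact: h.
  by rewrite -mulr_sumr ler_piMr// sum_mass// mass_le1.
rewrite -massKD; have := @Rintegral_near mu (K `\` D) 0 M mKD.
rewrite mul0r subr0; apply; first by move=> x [].
by move=> x [Kx _]; rewrite subr0 fM.
Qed.

End OneFunction.

End DiscreteApproximation.

(** * Basic neighbourhoods inside weakly open sets *)

Section BasicNeighbourhoods.
Variables (R : realType) (d : nat) (K : set (Rd R d)).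
Hypothesis cK : compact K.
Local Notation prob := (probability (BorelRd R d) R).
Local Notation meas A := (measurable (A : set (BorelRd R d))).
Implicit Types (mu nu : prob) (U V W : set prob) (A B : set (Rd R d)).

Lemma edist_gt0 (x y : Rd R d) : x != y -> 0 < edist x y.
Proof.
move=> xy; rewrite lt_def edist_ge0 andbT; apply: contraNneq xy => xy0.
apply/eqP/rowP => i; apply/eqP; rewrite -subr_eq0 -normr_le0 -xy0.
exact: coord_le_edist.
Qed.

Lemma fin_pos_lower_bound (I : finType) (g : I -> R) : (forall i, 0 < g i) ->
  exists2 e : R, 0 < e & forall i, e <= g i.
Proof.
move=> g0; exists (\big[Num.min/1]_i g i).
  by apply/lt_bigmin => //.
by move=> i; exact: bigmin_le_cond.
Qed.

Lemma separated (I : finType) (x : I -> Rd R d) : injective x ->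
  exists2 e : R, 0 < e & forall i j, i != j -> e <= edist (x i) (x j).
Proof.
move=> xinj; have [|e e0 h] := @fin_pos_lower_bound (I * I)%type
    (fun ij => if ij.1 == ij.2 then 1 else edist (x ij.1) (x ij.2)).
  move=> [i j] /=; case: ifPn => // ij; apply: edist_gt0.
  by apply: contraNneq ij => /xinj ->.
by exists e => // i j ij; have := h (i, j); rewrite /= (negbTE ij).
Qed.

Lemma eball_disjoint (x y : Rd R d) (r s : R) : r + s <= edist x y ->
  eball x r `&` eball y s = set0.
Proof.
move=> h; apply/seteqP; split=> // z [] /=; rewrite /eball /= => xz yz.
by have := edist_triangle z x y; rewrite (edist_sym z y); lra.
Qed.

Lemma le_sum_seq (T : eqType) (s : seq T) (g : T -> R) x :
  (forall y, 0 <= g y) -> x \in s -> g x <= \sum_(y <- s) g y.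
Proof. by move=> g0 xs; rewrite (big_rem x)//= lerDl sumr_ge0. Qed.

Definition atoms (I : finType) (x : I -> Rd R d) (p : I -> R) :=
  [/\ injective x, (forall i, K (x i)), (forall i, 0 < p i) & \sum_i p i = 1].

(** Cut [K] into finitely many cells on which the test functions hardly vary, move the mass of each
    non-null cell to one of its points, and let nu be close to the resulting discrete measure: its
    integrals are then close to those of [mu]. The neighbourhood found lies inside [U] but need not
    contain [mu]. *)
Lemma exists_basic_nbhd U mu : weak_open K U -> U mu ->
  exists (I : finType) (x : I -> Rd R d) (p : I -> R) (e : R),
    [/\ atoms x p, 0 < e & basic_nbhd K x p e `<=` U].
Proof.
move=> oU Umu; have muK := weak_open_sub oU Umu.
have [_ /(_ _ Umu)[fs [eps [cfs [eps0 fsU]]]]] := oU.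
have mK := measK cK; have mb := @eball_measurable R d.
have K1 : mass mu K = 1 by rewrite /mass muK.
(* The final comparison costs [6 * e1]: two to discretize [mu], two to change the weights, two to
   discretize [nu]. *)
pose e1 := eps / 8; have e10 : 0 < e1 by rewrite divr_gt0.
have /choice[rad radP] : forall x, exists r, K x -> 0 < r /\
    forall f, f \in fs -> forall y, K y -> eball x r y -> `|f x - f y| < e1.
  move=> x; have [Kx|] := pselect (K x); last by exists 0.
  elim: fs cfs {fsU} => [|f fs IH] cfs; first by exists 1.
  have [|r1 /(_ Kx)[r10 h1]] := IH.
    by move=> g gfs; apply: cfs; rewrite inE gfs orbT.
  have [|r2 r20 h2] := within_continuous_eball (e := e1) (cfs f (mem_head _ _)) Kx _.
    by [].
  exists (Num.min r1 r2) => _; split; first by rewrite lt_min r10.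
  move=> g; rewrite inE => /predU1P[->|gfs] y Ky; rewrite /eball /= lt_min => /andP[? ?].
    exact: h2.
  exact: h1.
have rad0 x : K x -> 0 < rad x by move=> /radP[].
have [s [sK scov]] := compact_eball_cover cK rad0.
(* A common bound for the test functions on [K]: each value is within [e1] of the value at some
   centre in [s]. *)
pose M := \sum_(f <- fs) \sum_(c <- s) `|f c| + e1.
have M0 : 0 <= M by rewrite addr_ge0 ?(ltW e10)// !sumr_ge0// => *; rewrite sumr_ge0.
have fM f x : f \in fs -> K x -> `|f x| <= M.
  move=> ffs Kx; have [c cs cx] := scov _ Kx.
  have [_ /(_ f ffs x Kx cx) h] := radP _ (sK _ cs).
  have h1 : `|f c| <= \sum_(c <- s) `|f c| by apply: (le_sum_seq (g := fun c => `|f c|)).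
  have h2 : \sum_(c <- s) `|f c| <= \sum_(f <- fs) \sum_(c <- s) `|f c|.
    by apply: (le_sum_seq (g := fun f => \sum_(c <- s) `|f c|)) => // *; rewrite sumr_ge0.
  have h3 : `|f x| <= `|f c| + `|f c - f x|.
    by rewrite -[in leLHS](subKr (f c) (f x)) (le_trans (ler_normB _ _)).
  by rewrite /M; lra.
pose F k := eball (nth 0 s k) (rad (nth 0 s k)).
pose C := fun k => K `&` seqDU F k.
have mC k : meas (C k).
  apply: measurableI => //; apply: measurableD; first exact: mb.
  by apply: bigsetU_measurable => *; exact: mb.
have dC i j : i != j -> C i `&` C j = set0.
  move=> ij; have /trivIsetP/(_ i j Logic.I Logic.I ij) h := @trivIset_seqDU _ F.
  by rewrite /C setIACA h setI0.
have CK : \big[setU/set0]_(i < size s) C i = K.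
  apply/seteqP; split=> x; rewrite -bigcup_mkord.
    by move=> [k _ []].
  move=> Kx; have [c cs cx] := scov _ Kx.
  have : (\big[setU/set0]_(k < size s) seqDU F k) x.
    rewrite -bigsetU_seqDU -bigcup_mkord; exists (index c s); first by rewrite /= index_mem.
    by rewrite /F nth_index.
  by rewrite -bigcup_mkord => -[k ks kx]; exists k.
pose J := [pred j : 'I_(size s) | 0 < mass mu (C j)].
pose I := 'I_#|J|.
have mass0J j : j \notin J -> mass mu (C j) = 0.
  by rewrite inE -leNgt => h; apply/eqP; rewrite eq_le h mass_ge0.
have /choice[x xC] : forall i : I, exists y, C (enum_val i) y.
  move=> i; have := enum_valP i; rewrite inE => h; apply: contrapT => /forallNP hn.
  move: h; rewrite (_ : C _ = set0) ?mass0 ?ltxx//.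
  by apply/seteqP; split=> // y /hn.
pose p (i : I) := mass mu (C (enum_val i)).
have Sp : \sum_i p i = 1.
  rewrite -(big_enum_val (A := J) (fun j : 'I_(size s) => mass mu (C j))) /= -K1 -CK.
  rewrite -(sum_mass mu predT (A := fun i : 'I_(size s) => C i))//; last first.
    by move=> i j ij; exact: dC.
  by rewrite big_mkcond; apply: eq_bigr => j _; case: ifPn => // /mass0J ->.
have xinj : injective x.
  move=> i j xij; apply: enum_val_inj; apply/val_inj/eqP; apply: contraT => ij.
  have /seteqP[h _] := dC _ _ ij.
  by have [] := h (x i); split; [exact: xC|rewrite xij; exact: xC].
have Kx i : K (x i) by have [] := xC i.
have [e2 e20 he2] := separated xinj.
have [e3 e30 he3] := fin_pos_lower_bound (fun i => rad0 _ (Kx i)).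
pose N : R := #|J|%:R; have N0 : 0 <= N by rewrite /N ler0n.
pose e4 := e1 / (M * N + 1); have MN : 0 < M * N + 1 by rewrite ltr_wpDl// mulr_ge0.
have e40 : 0 < e4 by rewrite divr_gt0.
(* [e2 / 2] makes the balls disjoint, [e3] keeps them where the test functions vary by less than
   [e1], and [e4] makes the mass outside them, at most [N * e], cost at most [e1] even against the
   bound [M]. *)
pose e := Num.min (e2 / 2) (Num.min e3 e4).
have e0 : 0 < e by rewrite !lt_min divr_gt0// e30 e40.
have ee2 : e + e <= e2.
  have h : e <= e2 / 2 by rewrite ge_min lexx.
  by lra.
have ee3 : e <= e3 by rewrite !ge_min lexx orbT.
have ee4 : M * (N * e) <= e1.
  have : e <= e4 by rewrite !ge_min lexx !orbT.
  rewrite /e4 ler_pdivlMr// => h; apply: le_trans h.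
  by rewrite mulrA mulrC ler_wpM2l ?(ltW e0)// lerDl.
exists I, x, p, e; split=> //.
  by split=> // i; have := enum_valP i; rewrite inE.
move=> nu [nuK hnu]; apply: fsU; split=> // f ffs.
have cf := cfs f ffs; have fMx y : K y -> `|f y| <= M by exact: fM.
rewrite !(intK_Rintegral cK cf fMx) -EFinB abse_EFin lte_fin.
pose B i := K `&` eball (x i) e.
have nuB i : mass nu (B i) = mass nu (eball (x i) e) by rewrite PK_massI.
have dB i j : i != j -> B i `&` B j = set0.
  by move=> ij; rewrite setIACA eball_disjoint ?setI0// (le_trans ee2)// he2.
have mB i : meas (B i) by exact: measurableI.
have := Rintegral_cells cK cf fMx (mu := nu) (B := B) (a := fun i => f (x i)) (e := e1)
  mB dB (fun i => @subIsetl _ _ _) nuK (ltW e10).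
have := Rintegral_cells cK cf fMx (mu := mu) (B := fun i : I => C (enum_val i))
  (a := fun i => f (x i)) (e := e1 + e1) _ _ (fun i => @subIsetl _ _ _) muK _.
set S1 := \sum_i f (x i) * mass mu (C (enum_val i)).
set S2 := \sum_i f (x i) * mass nu (B i).
have Sm1 : \sum_i mass nu (B i) <= 1 by rewrite sum_mass// mass_le1//; exact: bigsetU_measurable.
have Sm2 : 1 - \sum_i mass nu (B i) <= N * e.
  rewrite -Sp -sumrB (@le_trans _ _ (\sum_(i : I) e))//.
    by apply: ler_sum => i _; have := hnu i; rewrite nuB; lra.
  by rewrite sumr_const card_ord mulr_natl.
have S12 : `|S2 - S1| <= M * (2 * (N * e)).
  rewrite -sumrB (le_trans (ler_norm_sum _ _ _))//.
  (* As nu(B_i) - p_i > -e, its absolute value is at most nu(B_i) - p_i + 2e; in the sum of these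
     bounds the masses contribute at most 1 - 1 = 0. *)
  apply: (@le_trans _ _ (\sum_i M * (mass nu (B i) - p i + 2 * e))).
    apply: ler_sum => i _; rewrite -mulrBr normrM ler_pM ?fMx// ler_norml.
    by have := hnu i; rewrite -nuB /p; lra.
  rewrite -mulr_sumr ler_wpM2l// big_split /= sumrB Sp sumr_const card_ord.
  by rewrite -[_ *+ _]mulr_natl -/N mulrCA; lra.
have Sm3 : M * (1 - \sum_i mass nu (B i)) <= e1.
  by apply: le_trans ee4; rewrite ler_wpM2l.
rewrite Sp subrr mulr0 addr0 => hmu hnu1.
have {hmu} : `|Rintegral mu (K : set (BorelRd R d)) f - S1| <= e1 + e1.
  apply: hmu => [i|i j ij||i y [Ky [Fy _]]].
  - exact: mC.
  - by apply: dC; apply: contraNneq ij => /val_inj/enum_val_inj ->.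
  - by rewrite addr_ge0// ltW.
  - have [_ [Fx _]] := xC i.
    have Kc : K (nth 0 s (enum_val i)) by apply: sK; rewrite mem_nth.
    have [_ h] := radP _ Kc.
    have := h f ffs _ Ky Fy; have := h f ffs _ (Kx i) Fx; rewrite !ltr_norml ler_norml.
    by move=> /andP[? ?] /andP[? ?]; apply/andP; split; lra.
have {hnu1} : `|Rintegral nu (K : set (BorelRd R d)) f - S2| <=
    e1 + M * (1 - \sum_i mass nu (B i)).
  apply: hnu1 => i y [Ky yx]; rewrite distrC ltW//.
  have [_ h] := radP _ (Kx i); apply: h => //.
  by apply: lt_le_trans yx _; rewrite (le_trans ee3).
move: (Rintegral mu _ f) (Rintegral nu _ f) => a b.
have eE : eps = 8 * e1 by rewrite /e1 mulrC divfK.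
have S12' : `|S2 - S1| <= 2 * e1.
  by apply: le_trans S12 _; rewrite mulrCA ler_wpM2l.
move: S12'; rewrite !ler_norml ltr_norml => /andP[? ?] /andP[? ?] /andP[? ?].
by apply/andP; split; lra.
Qed.

End BasicNeighbourhoods.

(** * Discrete measures in basic neighbourhoods *)

Section DiscreteInPK.
Variables (R : realType) (d : nat) (K : set (Rd R d)).
Hypothesis cK : compact K.

Lemma discrete_PK (I : finType) (x : I -> Rd R d) (p : I -> R) :
  (forall i, K (x i)) -> (forall i, 0 <= p i) -> \sum_i p i = 1 ->
  exists mu : probability (BorelRd R d) R,
    PK K mu /\ forall A, mass mu (A : set (BorelRd R d)) = \sum_(i | x i \in A) p i.
Proof.
move=> Kx p0 p1; have [mu muE] := exists_discrete x p0 p1.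
exists mu; split=> //; rewrite /PK /= massE ?muE; last exact: measK.
congr EFin; rewrite -[RHS]p1; apply: eq_bigl => i.
by rewrite mem_set.
Qed.

(** Meant for measures obtained by replacing each atom [x i] by a cloud of nearby atoms, selected by
    [P], of about the same total weight. *)
Lemma discrete_basic (I J : finType) (x : I -> Rd R d) (p : I -> R) (e : R)
    (y : J -> Rd R d) (q : J -> R) (mu : probability (BorelRd R d) R) :
  PK K mu -> (forall j, 0 <= q j) ->
  (forall A, mass mu (A : set (BorelRd R d)) = \sum_(j | y j \in A) q j) ->
  (forall i, exists2 P : pred J, (forall j, P j -> edist (x i) (y j) < e) &
    p i - e < \sum_(j | P j) q j) ->
  basic_nbhd K x p e mu.
Proof.
move=> muK q0 muE h; split=> // i; have [P Px] := h i.
move=> /lt_le_trans; apply; rewrite muE.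
rewrite [leRHS](bigID P) /= -[leLHS]addr0 lerD ?sumr_ge0//.
rewrite le_eqVlt; apply/orP; left; apply/eqP; apply: eq_bigl => j.
case: (boolP (P j)) => [Pj|]; last by rewrite andbF.
by rewrite andbT; apply/esym/mem_set; exact: Px.
Qed.

Lemma discrete_basic_self (I : finType) (x : I -> Rd R d) (p : I -> R) (e : R)
    (mu : probability (BorelRd R d) R) :
  PK K mu -> (forall i, 0 <= p i) -> 0 < e ->
  (forall A, mass mu (A : set (BorelRd R d)) = \sum_(i | x i \in A) p i) ->
  basic_nbhd K x p e mu.
Proof.
move=> muK p0 e0 muE; apply: (discrete_basic muK p0 muE) => i.
exists (pred1 i) => [j /eqP ->|]; first by rewrite edistxx.
by rewrite big_pred1_eq; lra.
Qed.

End DiscreteInPK.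

(** * Couplings and divisibility of Lebesgue measure *)

Section Coupling.
Variable R : realType.

(** Add to the partial coupling the product of the two residual marginals divided by their common
    total mass [w]. *)
Lemma complete_coupling (I J : finType) (p : I -> R) (q : J -> R)
    (g : I -> J -> R) :
  \sum_i p i = 1 -> \sum_j q j = 1 -> (forall i j, 0 <= g i j) ->
  (forall i, \sum_j g i j <= p i) -> (forall j, \sum_i g i j <= q j) ->
  exists pi : I -> J -> R, [/\ (forall i j, g i j <= pi i j),
    (forall i, \sum_j pi i j = p i) & (forall j, \sum_i pi i j = q j)].
Proof.
move=> p1 q1 g0 gp gq.
pose r i := p i - \sum_j g i j; pose c j := q j - \sum_i g i j.
have r0 i : 0 <= r i by rewrite subr_ge0.
have c0 j : 0 <= c j by rewrite subr_ge0.
pose w := 1 - \sum_i \sum_j g i j.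
have rw : \sum_i r i = w by rewrite sumrB p1.
have cw : \sum_j c j = w by rewrite sumrB q1 exchange_big.
(* If [w = 0], division gives 0 by convention, and the residuals vanish, so the identity
   persists. *)
have w_div (T : finType) (u : T -> R) t : (forall t, 0 <= u t) -> \sum_t u t = w ->
    u t * w / w = u t.
  move=> u0 uw; have [w0|w0] := eqVneq w 0; last by rewrite mulfK.
  rewrite w0 !mulr0 mul0r; apply/esym/eqP.
  move: uw; rewrite w0 => /eqP; rewrite psumr_eq0// => /allP/(_ t).
  by rewrite mem_index_enum => /(_ isT).
exists (fun i j => g i j + r i * c j / w); split.
- by move=> i j; rewrite lerDl divr_ge0 ?mulr_ge0// -rw sumr_ge0.
- move=> i; rewrite big_split /= -mulr_suml -mulr_sumr cw w_div//.
  by rewrite addrC subrK.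
- move=> j; rewrite big_split /= -!mulr_suml rw.
  by rewrite [w * _]mulrC w_div// addrC subrK.
Qed.

Let leb := @lebesgue_measure R.

Definition unit_lebesgue := mrestr leb (measurable_itv `[(0:R), 1]).

Let unit_lebesgueT : unit_lebesgue setT = 1%E.
Proof. by rewrite /unit_lebesgue /mrestr setTI /leb lebesgue_measure_itv /= lte01 oppr0 adde0. Qed.

Lemma exists_unit_lebesgue : exists P : probability (measurableTypeR R) R,
  forall A : set R, P A = leb (A `&` `[0, 1]%classic).
Proof.
have [|P PE] := @probability_of_measure R _ (measurableTypeR R) unit_lebesgue 0.
  exact: unit_lebesgueT.
by exists P => A; rewrite PE.
Qed.

Variable P : probability (measurableTypeR R) R.
Hypothesis PE : forall A : set R, P A = leb (A `&` `[0, 1]%classic).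
Local Notation mass := (@mass R _ (measurableTypeR R) P).

Lemma mass_itv_le (s t : R) : s <= t -> mass `]s, t]%classic <= t - s.
Proof.
move=> st; rewrite -lee_fin -massE// PE.
apply: (@le_trans _ _ (leb `]s, t]%classic)).
  apply: le_measure; rewrite ?inE; [exact: measurableI|exact: measurable_itv|].
  exact: subIsetl.
by rewrite /leb lebesgue_measure_itv /= lte_fin; case: ltP => // ts; rewrite lee_fin subr_ge0.
Qed.

(** The mass of [A] to the left of t is continuous in t and grows from 0 at -1 to the mass of [A] at
    1; apply the intermediate value theorem. *)
Lemma atomless_subset (A : set R) (m : R) : measurable A -> 0 <= m <= mass A ->
  exists B : set R, [/\ measurable B, B `<=` A & mass B = m].
Proof.
move=> mA /andP[m0 mA1].
pose F (t : R) := mass (A `&` `]-oo, t]%classic).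
have mF t : measurable (A `&` `]-oo, t]%classic) by exact: measurableI.
have FB (s t : R) : s <= t -> 0 <= F t - F s <= t - s.
  move=> st; have -> : F t = F s + mass (A `&` `]s, t]%classic).
    have mst : measurable (A `&` `]s, t]%classic) by exact: measurableI.
    rewrite /F -(massU P (mF s) mst).
      congr fine; congr (P _).
      apply/seteqP; split=> [x [Ax]|x [[Ax]|[Ax]]]; rewrite /= !in_itv /=.
      - by move=> xt; have [xs|xs] := leP x s; [left|right]; rewrite ?xs ?xt.
      - by move=> xs; split=> //; exact: le_trans st.
      - by move=> /andP[_ xt].
    apply/seteqP; split=> // x [[_ /=]]; rewrite !in_itv/= => xs [_].
    by rewrite ltNge xs.
  rewrite addrAC subrr add0r mass_ge0 /=; apply: le_trans (mass_itv_le st).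
  by apply: mass_le => //; exact: measurableI.
have cF : continuous F.
  move=> t; apply/cvgrPdist_lt => e e0; near=> s.
  have ts : `|t - s| < e by near: s; apply: cvgr_dist_lt.
  apply: le_lt_trans ts; rewrite ler_norml.
  have [st|/ltW st] := leP s t.
    by have /andP[? ?] := FB _ _ st; rewrite ger0_norm ?subr_ge0//; apply/andP; split; lra.
  have /andP[? ?] := FB _ _ st; rewrite ler0_norm ?subr_le0//; apply/andP; split; lra.
have F1 : F (-1) = 0.
  have A0 : A `&` `]-oo, -1]%classic `&` `[0, 1]%classic = set0.
    apply/seteqP; split=> // x [[_]] /=; rewrite !in_itv /= => x1 /andP[x0 _].
    lra.
  by rewrite /F /mass PE A0 /leb measure0.
have F2 : F 1 = mass A.
  rewrite /F /mass !PE; congr (fine (leb _)); apply/seteqP; split=> [x [[Ax _]]//|x [Ax]] /=.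
  by rewrite in_itv /= => /andP[? ?]; rewrite !in_itv /=; do !split=> //; apply/andP.
have [|||c _ Fc] := @IVT R F (-1) 1 m.
- lra.
- exact: continuous_subspaceT.
- by rewrite F1 F2 ge_min m0 /= le_max mA1 orbT.
exists (A `&` `]-oo, c]%classic); split=> //; exact: subIsetl.
Unshelve. all: by end_near. Qed.

Lemma atomless_partition (J : finType) (A : set R) (m : J -> R) : measurable A ->
  (forall j, 0 <= m j) -> \sum_j m j = mass A ->
  exists S : J -> set R, [/\ (forall j, measurable (S j)), (forall j, S j `<=` A),
    (forall i j, i != j -> S i `&` S j = set0) & (forall j, mass (S j) = m j)].
Proof.
move=> mA m0.
suff : forall s : seq J, uniq s -> forall B : set R, measurable B ->
   \sum_(j <- s) m j = mass B ->
   exists S : J -> set R, [/\ (forall j, measurable (S j)), (forall j, S j `<=` B),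
    (forall i j, i != j -> S i `&` S j = set0) & (forall j, j \in s -> mass (S j) = m j)].
  move=> h mE; have [|S [? ? ? hS]] := h _ (index_enum_uniq J) A mA.
    by rewrite mE.
  by exists S; split=> // j; apply: hS; exact: mem_index_enum.
elim=> [|j s IH] /=.
  by move=> _ B mB _; exists (fun=> set0); split=> // *; rewrite ?set0I.
move=> /andP[js us] B mB; rewrite big_cons => mE.
have [|C [mC CB mCj]] := @atomless_subset B (m j) mB.
  by rewrite m0 /= -mE lerDl sumr_ge0.
have mBC : measurable (B `\` C) by exact: measurableD.
have [|S [mS SB dS SE]] := IH us (B `\` C) mBC.
  apply: (@addrI _ (m j)); rewrite mE -mCj -massU//; first by rewrite setDUK.
  by rewrite setDIK.
exists (fun i => if i == j then C else S i); split.
- by move=> i; case: ifP.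
- by move=> i; case: ifP => // _ x /SB[].
- move=> i i' ii'; case: ifPn => [/eqP ij|ij]; case: ifPn => [/eqP i'j|i'j].
  + by move: ii'; rewrite ij i'j eqxx.
  + by apply/seteqP; split=> // x [Cx /SB[]].
  + by apply/seteqP; split=> // x [/SB[]].
  + exact: dS.
- move=> i; rewrite inE => /predU1P[->|si]; first by rewrite eqxx.
  by case: ifPn => [/eqP ij|_]; [rewrite ij|exact: SE].
Qed.

End Coupling.

(** * Coupling two discrete laws on the auxiliary space *)

Section Stages.
Variables (R : realType) (d : nat) (K : set (Rd R d)).
Hypothesis cK : compact K.
Variable P : probability (measurableTypeR R) R.
Hypothesis PE : forall A : set R,
  P A = @lebesgue_measure R (A `&` `[0, 1]%classic).

(* a family of sets carrying, on the auxiliary space [P], the law [sum p_i delta_{x_i}] *)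
Definition realizes (I : finType) (p : I -> R) (S : I -> set R) :=
  [/\ (forall i, measurable (S i : set (measurableTypeR R))),
      (forall i j, i != j -> S i `&` S j = set0) &
      (forall i, mass P (S i : set (measurableTypeR R)) = p i)].

(** Let Q_i be the [nu]-mass of the ball B(x_i,e). Send the mass min(p_i, Q_i) from x_i to the atoms
    y_j in that ball; as Q_i > p_i - e, at most |I| e stays unmatched. After completing this to a
    coupling, each [S i] is cut accordingly, and the new set of index j collects the pieces sent to
    y_j. Off a set of mass |I| e, points then move by less than [e]. *)
Lemma couple_step (I J : finType) (x : I -> Rd R d) (p : I -> R)
    (y : J -> Rd R d) (q : J -> R) (e : R) (nu : probability (BorelRd R d) R)
    (S : I -> set R) :
  (forall i, 0 <= p i) -> \sum_i p i = 1 -> (forall j, 0 <= q j) -> \sum_j q j = 1 ->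
  (forall i i', i != i' -> e + e <= edist (x i) (x i')) -> 0 <= e ->
  (forall A, mass nu (A : set (BorelRd R d)) = \sum_(j | y j \in A) q j) ->
  basic_nbhd K x p e nu -> realizes p S ->
  exists (S' : J -> set R) (G : set R), [/\ realizes q S',
    measurable (G : set (measurableTypeR R)),
    1 - #|I|%:R * e <= mass P (G : set (measurableTypeR R)) &
    forall t, G t -> exists i j, [/\ S i t, S' j t & edist (x i) (y j) < e]].
Proof.
move=> p0 p1 q0 q1 sep e0 nuE [_ hnu] [mS dS SE].
pose B i := [pred j | edist (x i) (y j) < e].
pose Q i := \sum_(j | B i j) q j.
have QE i : p i - e < Q i.
  have := hnu i; rewrite nuE; congr (_ < _); apply: eq_bigl => j.
  by apply/idP/idP; [move=> /set_mem|move=> h; apply/mem_set].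
have Q0 i : 0 <= Q i by apply: sumr_ge0.
pose w i := Num.min (p i) (Q i).
have w0 i : 0 <= w i by rewrite le_min p0 Q0.
(* The mass [w i] leaving x_i is spread over the nearby y_j proportionally to [q j]. *)
pose g i j := if B i j then q j * (w i / Q i) else 0.
have wQ i : 0 <= w i / Q i <= 1.
  rewrite divr_ge0//=; have [->|Qn0] := eqVneq (Q i) 0; first by rewrite invr0 mulr0.
  by rewrite ler_pdivrMr ?mul1r ?ge_min ?lexx ?orbT// lt_def Qn0 Q0.
have g0 i j : 0 <= g i j.
  by rewrite /g; case: ifP => // _; rewrite mulr_ge0//; have /andP[] := wQ i.
have gE i : \sum_(j | B i j) g i j = w i.
  rewrite (eq_bigr (fun j => q j * (w i / Q i))); last by move=> j; rewrite /g => ->.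
  rewrite -mulr_suml -/(Q i); have [Qi0|Qn0] := eqVneq (Q i) 0; last by rewrite mulrC divfK.
  rewrite Qi0 mul0r /w Qi0; apply/esym/eqP; rewrite eq_le le_min p0 lexx andbT.
  by rewrite ge_min lexx orbT.
have gE' i : \sum_j g i j = w i.
  rewrite -gE [RHS]big_mkcond; apply: eq_bigr => j _.
  by rewrite /g; case: ifP.
have gp i : \sum_j g i j <= p i by rewrite gE' ge_min lexx.
have gq j : \sum_i g i j <= q j.
  have [/existsP[i0 Bi0]|/existsPn hn] := boolP [exists i, B i j]; last first.
    by rewrite big1// => i _; rewrite /g (negbTE (hn i)).
  rewrite (bigD1 i0)//= big1 ?addr0 => [|i ii0].
    by rewrite /g Bi0 ler_piMr//; have /andP[] := wQ i0.
  rewrite /g; case: ifPn => // Bi; have := sep _ _ ii0.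
  have := edist_triangle (y j) (x i) (x i0); rewrite (edist_sym (y j)).
  by move: Bi Bi0; rewrite /B /=; lra.
have [pi [gpi pip piq]] := complete_coupling p1 q1 g0 gp gq.
have pi0 i j : 0 <= pi i j by apply: le_trans (gpi i j).
have /choice[T hT] : forall i, exists T : J -> set R,
  [/\ (forall j, measurable (T j : set (measurableTypeR R))),
      (forall j, T j `<=` S i),
      (forall j j', j != j' -> T j `&` T j' = set0) &
      (forall j, mass P (T j : set (measurableTypeR R)) = pi i j)].
  move=> i; have [||T [? ? ? ?]] := @atomless_partition R P PE J (S i) (pi i) (mS i).
  - by [].
  - by rewrite pip SE.
  - by exists T.
have mT i j : measurable (T i j : set (measurableTypeR R)) by have [] := hT i.
have TS i j : T i j `<=` S i by have [] := hT i.
have dT i i' j j' : (i, j) != (i', j') -> T i j `&` T i' j' = set0.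
  have [->|ii'] := eqVneq i i'.
    move=> jj'; have [_ _ + _] := hT i'; apply.
    by apply: contraNneq jj' => ->.
  move=> _; apply/seteqP; split=> // t [/TS Sit /TS Si't].
  by rewrite -(dS _ _ ii').
exists (fun j => \big[setU/set0]_i T i j).
exists (\big[setU/set0]_(ij : I * J | B ij.1 ij.2) T ij.1 ij.2); split.
- split.
  + by move=> j; apply: bigsetU_measurable.
  + move=> j j' jj'; apply/seteqP; split=> // t [].
    rewrite -!bigcup_seq => -[i _ Tij] [i' _ Ti'j'].
    rewrite -(dT i i' j j'); first by split.
    by apply: contraNneq jj' => -[_ ->].
  + move=> j; rewrite -piq -sum_mass//; last first.
      by move=> i i' ii'; apply: dT; apply: contraNneq ii' => -[->].
    by apply: eq_bigr => i _; have [_ _ _ ->] := hT i.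
- exact: bigsetU_measurable.
- rewrite -(sum_mass P (fun ij => B ij.1 ij.2) (A := fun ij => T ij.1 ij.2))//; last first.
    by move=> [i j] [i' j'] /= h; exact: dT.
  rewrite (eq_bigr (fun ij => pi ij.1 ij.2)); last first.
    by move=> [i j] _ /=; have [_ _ _ ->] := hT i.
  rewrite -(pair_big_dep predT (fun i j => B i j) (fun i j => pi i j)) /=.
  apply: (@le_trans _ _ (\sum_i w i)).
    rewrite mulr_natl -[X in X - _]p1 -sumr_const -sumrB; apply: ler_sum => i _.
    by rewrite le_min gerBl e0 ltW// QE.
  by apply: ler_sum => i _; rewrite -gE; apply: ler_sum => j _.
- move=> t; rewrite -bigcup_seq_cond => -[[i j] /= /andP[_ Bij] Tt].
  exists i, j; split=> //; first exact: TS Tt.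
  by rewrite -bigcup_seq; exists i => //=; exact: mem_index_enum.
Qed.

End Stages.

(** * The limit of a sequence of coupled stages *)

Section LimitLaw.
Variables (R : realType) (d : nat) (K : set (Rd R d)).
Hypothesis cK : compact K.
Variable P : probability (measurableTypeR R) R.
Variables (I : nat -> finType) (x : forall n, I n -> Rd R d)
  (p : forall n, I n -> R) (e : nat -> R) (S : forall n, I n -> set R)
  (G : nat -> set R) (x0 : Rd R d).
Local Notation mP A := (mass P (A : set (measurableTypeR R))).
Local Notation measR A := (measurable (A : set (measurableTypeR R))).
Hypothesis Kx0 : K x0.
Hypothesis Kx : forall n i, K (@x n i).
Hypothesis e_gt0 : forall n, 0 < e n.
Hypothesis e_half : forall n, e n.+1 <= e n / 2.
Hypothesis rS : forall n, realizes P (@p n) (@S n).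
Hypothesis mG : forall n, measR (G n).
Hypothesis G_ge : forall n, 1 - e n / 8 <= mP (G n).
Hypothesis G_step : forall n t, G n t -> exists i j,
  [/\ @S n i t, @S n.+1 j t & edist (@x n i) (@x n.+1 j) < e n / 8].

(** The value at t of the simple function X_n equal to x_i on S_i, written as a relation since the
    S_i need not cover the line. *)
Let at_ n t z := exists i, @S n i t /\ z = @x n i.

Let at_uniq n t z z' : at_ n t z -> at_ n t z' -> z = z'.
Proof.
move=> [i [it ->]] [j [jt ->]]; have [->//|ij] := eqVneq i j.
have [_ dS _] := rS n; have /seteqP[h _] := dS _ _ ij.
by have [] := h t.
Qed.

(** Where all steps from n on are short, so that X_n(t), X_{n+1}(t), ... is a Cauchy sequence. *)
Let D n := \bigcap_k G (n + k).

Let mD n : measR (D n).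
Proof. by apply: bigcap_measurable => // k _; exact: mG. Qed.

(** A quantitative Borel-Cantelli argument: since [e] at least halves each time, the exceptional
    masses e_{n+k}/8 add up to at most e_n/4. *)
Lemma mass_D n : 1 - e n / 4 <= mP (D n).
Proof.
pose F l := \big[setI/setT]_(k < l) G (n + k).
have mF l : measR (F l) by apply: bigsetI_measurable => k _; exact: mG.
have FE l t : F l t <-> forall k, (k < l)%N -> G (n + k) t.
  rewrite /F; elim: l => [|l IH]; first by rewrite big_ord0.
  rewrite big_ord_recr; split=> [[/IH h Gl] k|h].
    by rewrite ltnS leq_eqVlt => /predU1P[->//|]; exact: h.
  by split; [apply/IH => k kl; apply: h; exact: ltnW|exact: h].
have FD : D n = \bigcap_l F l.
  apply/seteqP; split=> t Dt.
    by move=> l _; apply/FE => k _; exact: Dt.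
  by move=> k _; apply: (FE k.+1 t).1 => //; exact: Dt.
(* Telescoping: e_{k+1} <= e_k/2 gives e_k/8 <= (e_k - e_{k+1})/4. *)
have F_ge l : 1 - (e n - e (n + l)) / 4 <= mP (F l).
  elim: l => [|l IH]; first by rewrite /F big_ord0 massT addn0; lra.
  rewrite /F big_ord_recr /= -/(F l); have := massI_ge P (mF l) (mG (n + l)).
  have := G_ge (n + l); have := e_half (n + l); rewrite addnS; lra.
have cv : (P \o (F : nat -> set (measurableTypeR R))) x @[x --> \oo] --> P (\bigcap_l F l).
  apply: nonincreasing_cvg_mu => //.
  - by rewrite (le_lt_trans (probability_le1 _ (mF 0%N)))// ltry.
  - by rewrite -FD.
  - move=> a b ab; apply/subsetPset => t /FE h; apply/FE => k ka.
    by apply: h; exact: leq_trans ab.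
rewrite -FD in cv.
rewrite -lee_fin -(massE _ (mD n)) -(cvg_lim _ cv)//; apply: lime_ge.
  by apply/cvg_ex; eexists; exact: cv.
apply: nearW => l /=; rewrite massE ?lee_fin; last exact: mF.
by have := F_ge l; have := e_gt0 (n + l); lra.
Qed.

Let e_mono n k : e (n + k) <= e n.
Proof.
elim: k => [|k IH]; first by rewrite addn0.
by have := e_half (n + k); have := e_gt0 (n + k); rewrite addnS; lra.
Qed.

Let e_small (r : R) : 0 < r -> exists n, forall k, (n <= k)%N -> e k < r.
Proof.
move=> r0; have h n : e n <= e 0%N / n.+1%:R.
  elim: n => [|n IH]; first by rewrite divr1.
  apply: le_trans (e_half n) _; rewrite ler_pdivrMr//.
  apply: le_trans IH _; rewrite -mulrA ler_wpM2l ?(ltW (e_gt0 _))//.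
  rewrite [leRHS]mulrC ler_pdivlMr// mulrC ler_pdivrMr// -natrM ler_nat.
  by rewrite mul2n -addnn addSn ltnS addnS ltnS leq_addr.
have [n hn] : exists n : nat, e 0%N / r < n%:R.
  by exists (Num.bound (e 0%N / r)); apply: archi_boundP; rewrite divr_ge0// ltW.
exists n => k nk; apply: le_lt_trans (h k) _.
rewrite ltr_pdivrMr// mulrC -ltr_pdivrMr//; apply: lt_le_trans hn _.
by rewrite ler_nat (leq_trans nk).
Qed.

(** The steps telescope to distances at most e_{n+k}/4, which pass to a cluster point provided by
    the compactness of [K]. *)
Let exists_limit_point n t : D n t -> exists c, K c /\
  forall k z, at_ (n + k) t z -> edist z c <= e (n + k) / 4.
Proof.
move=> Dt.
have /choice[u hu] : forall k, exists z, at_ (n + k) t z.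
  by move=> k; have [i [j [it _ _]]] := G_step (Dt k Logic.I); exists (x i), i.
have u_step k : edist (u k) (u k.+1) < e (n + k) / 8.
  have [i [j [it jt ij]]] := G_step (Dt k Logic.I).
  have -> : u k = x i by apply: at_uniq (hu k) _; exists i.
  have hj : at_ (n + k.+1) t (x j) by rewrite addnS; exists j.
  by rewrite (at_uniq (hu k.+1) hj).
have u_dist k l : edist (u k) (u (k + l)%N) <= (e (n + k) - e (n + (k + l))) / 4.
  elim: l => [|l IH]; first by rewrite addn0 edistxx subrr mul0r.
  rewrite addnS; have := edist_triangle (u (k + l)%N) (u k) (u (k + l).+1).
  have := u_step (k + l)%N; have := e_half (n + (k + l)); rewrite addnS; lra.
have Ku k : K (u k) by have [i [_ ->]] := hu k.
have [|c [Kc cc]] := cK (F := u @ \oo) _.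
  by exists 0%N => // k _; exact: Ku.
exists c; split=> // k z zt; have -> : z = u k by exact: at_uniq zt (hu k).
apply/ler_addgt0Pr => r r0.
have c_ball : nbhs c (eball c r) by apply/nbhs_eball; exists r.
have c_tail : (u @ \oo) [set u (k + l)%N | l in setT].
  by exists k => // l /= kl; exists (l - k)%N => //; rewrite subnKC.
have [y [[l _ ul] cy]] := cc _ _ c_tail c_ball.
move: cy; rewrite -ul /eball /= edist_sym => cy.
have := edist_triangle (u (k + l)%N) (u k) c.
by have := u_dist k l; have := e_gt0 (n + (k + l)); lra.
Qed.

Let exists_limit_fun : exists X : R -> Rd R d, [/\ (forall t, K (X t)),
  (forall t, ~ (exists n, D n t) -> X t = x0) &
  (forall n t, D n t -> forall k z, at_ (n + k) t z ->
     edist z (X t) <= e (n + k) / 4)].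
Proof.
suff /choice[X hX] : forall t, exists c, [/\ K c,
    ~ (exists n, D n t) -> c = x0 &
    forall n, D n t -> forall k z, at_ (n + k) t z -> edist z c <= e (n + k) / 4].
  exists X; split.
  - by move=> t; have [] := hX t.
  - by move=> t; have [] := hX t.
  - by move=> n t; have [_ _] := hX t; exact.
move=> t; have [Dt|Dt] := pselect (exists n, D n t); last first.
  by exists x0; split=> // n Dnt; case: Dt; exists n.
have Dt' : exists n, `[< D n t >] by case: Dt => n Dn; exists n; apply/asboolP.
(* With the least admissible index, the estimate of [exists_limit_point] covers all other indices at
   once. *)
case: (ex_minnP Dt') => n0 /asboolP Dn0 n0_min.
have [c [Kc hc]] := exists_limit_point Dn0.
exists c; split=> // n /asboolP/n0_min n0n k z.
by rewrite -(subnKC n0n) -addnA; exact: hc.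
Qed.

(** Where some [D n] holds, the limit lies in an open U exactly when, for some m, the ball of radius
    1/(m+1) about X_k(t) lies in U for all large k. This expresses the preimage of U through the
    sets S_i by countable operations; elsewhere X is constant. *)
Let measurable_limit_fun (X : R -> Rd R d) :
  (forall t, ~ (exists n, D n t) -> X t = x0) ->
  (forall n t, D n t -> forall k z, at_ (n + k) t z ->
     edist z (X t) <= e (n + k) / 4) ->
  measurable_fun (setT : set (measurableTypeR R))
    (X : measurableTypeR R -> BorelRd R d).
Proof.
move=> X0 XD; apply: (@measurability _ _ _ (BorelRd R d) setT X (@open (Rd R d)) erefl).
move=> _ [U oU <-].
rewrite setTI.
pose A m k := [set t | exists2 i, @S k i t & eball (@x k i) m.+1%:R^-1 `<=` U].
have mA m k : measR (A m k).
  rewrite [X in measurable X](_ : _ = \big[setU/set0]_(i : I k |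
      `[< eball (@x k i) m.+1%:R^-1 `<=` U >]) @S k i).
    by apply: bigsetU_measurable => i _; have [] := rS k.
  apply/seteqP; split=> t; rewrite -bigcup_seq_cond.
    by move=> [i it iU]; exists i => //=; rewrite mem_index_enum; apply/asboolP.
  by move=> [i /= /andP[_ /asboolP iU] it]; exists i.
pose DD := \bigcup_n D n.
have mDD : measR DD by apply: bigcup_measurable => n _; exact: mD.
pose V := \bigcup_m \bigcup_n \bigcap_k A m (n + k)%N.
have mV : measR V.
  apply: bigcup_measurable => m _; apply: bigcup_measurable => n _.
  by apply: bigcap_measurable => // k _; exact: mA.
rewrite [X in measurable X](_ : _ = (DD `&` V) `|` (~` DD `&` [set _ | U x0])).
  apply: measurableU; first exact: measurableI.
  apply: measurableI; first exact: measurableC.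
  have [Ux0|Ux0] := pselect (U x0).
    by rewrite (_ : [set _ | _] = setT)//; apply/seteqP; split.
  by rewrite (_ : [set _ | _] = set0)//; apply/seteqP; split.
apply/seteqP; split=> t /=.
  have [[n _ Dnt] UX|DDt] := pselect (DD t); last first.
    by rewrite X0 => [? |[n Dn]]; [right|apply: DDt; exists n].
  left; split; first by exists n.
  have /nbhs_eball[r r0 rU] : nbhs (X t) U by exact: open_nbhs_nbhs.
  have r20 : 0 < r / 2 by rewrite divr_gt0.
  have [m _ /(_ m (leqnn m)) hm] := near_infty_natSinv_lt (PosNum r20).
  have {}hm : m.+1%:R^-1 < r / 2 := hm.
  have [n1 hn1] := e_small r20.
  exists m => //; exists (n + n1)%N => // k _.
  have [i [j [it _ _]]] := G_step (Dnt (n1 + k)%N Logic.I).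
  rewrite -addnA; exists i => //; apply: subset_trans rU; apply: le_eball.
  have : edist (X t) (x i) <= e (n + (n1 + k)) / 4.
    by rewrite edist_sym; apply: (XD n) => //; exists i.
  have : e (n + (n1 + k)) < r / 2.
    by apply: hn1; rewrite addnCA leq_addr.
  by move: hm; move: (m.+1%:R^-1) => w hm; have := e_gt0 (n + (n1 + k)); lra.
move=> [[[n _ Dnt] [m _ [n1 _ Vt]]]|[DDt Ux0]]; last first.
  by rewrite X0// => -[n Dn]; apply: DDt; exists n.
have m0 : 0 < m.+1%:R^-1 :> R by rewrite invr_gt0.
have [n2 hn2] := e_small m0.
have [i it] := Vt (n + n2)%N Logic.I; apply.
have h1 : e (n1 + (n + n2)) < m.+1%:R^-1 by apply: hn2; rewrite addnA leq_addl.
have := XD n t Dnt (n1 + n2)%N (x i).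
rewrite (_ : (n + (n1 + n2) = n1 + (n + n2))%N); last by rewrite addnCA.
move=> /(_ (ex_intro _ i (conj it erefl))) h2.
rewrite /eball /=; apply: le_lt_trans h2 _; apply: le_lt_trans h1.
by have := e_gt0 (n1 + (n + n2)); lra.
Qed.

(** The measure is the law of the limit X. On the intersection of S_i and [D n], X is within e_n/4
    of x_i, so B(x_i,e_n) receives at least p_i - e_n/4. *)
Lemma exists_limit_law : exists mu, forall n, basic_nbhd K (@x n) (@p n) (e n) mu.
Proof.
have [X [KX X0 XD]] := exists_limit_fun.
have mX := measurable_limit_fun X0 XD.
pose m := measure_function_pushforward__canonical__measure_function_Measure P mX.
have [|mu muE] := @probability_of_measure _ _ (BorelRd R d) m (0 : Rd R d).
  exact: probability_setT.
exists mu => n; split.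
  rewrite /PK /= muE; rewrite -(@probability_setT _ _ _ P); congr (P _).
  by apply/seteqP; split=> // t _; exact: KX.
move=> i; have [mS dS SE] := rS n.
have := massI_ge P (mS i) (mD n); rewrite SE.
have := mass_D n; have := e_gt0 n.
suff : mP (@S n i `&` D n) <= mass mu (eball (@x n i) (e n)) by lra.
have -> : mass mu (eball (@x n i) (e n)) = mP (X @^-1` eball (@x n i) (e n)).
  by rewrite /mass muE.
apply: mass_le; first exact: measurableI.
  rewrite -[Y in measurable Y]setTI.
  exact: (mX measurableT _ (eball_measurable _ _)).
move=> t [it Dt]; rewrite /eball /=.
have : edist (x i) (X t) <= e n / 4.
  by have := XD n t Dt 0%N (x i); rewrite addn0; apply; exists i.
by have := e_gt0 n; lra.
Qed.

End LimitLaw.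

(** * One round of the Baire construction *)

Section BaireCategory.
Variables (R : realType) (d : nat) (K : set (Rd R d)).
Hypothesis cK : compact K.
Local Notation prob := (probability (BorelRd R d) R).
Implicit Types (mu nu : prob) (U V W : set prob).

Lemma basic_nbhd_le (I : finType) (x : I -> Rd R d) (p : I -> R) (e e' : R) :
  e' <= e -> basic_nbhd K x p e' `<=` basic_nbhd K x p e.
Proof.
move=> ee' nu [nuK h]; split=> // i; have := h i.
have : mass nu (eball (x i) e') <= mass nu (eball (x i) e).
  by apply: mass_le; [exact: eball_measurable|exact: eball_measurable|
    apply: le_eball; rewrite edistxx add0r].
by lra.
Qed.

Lemma atoms_basic_nonempty (I : finType) (x : I -> Rd R d) (p : I -> R) (e : R) :
  atoms K x p -> 0 < e -> basic_nbhd K x p e !=set0.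
Proof.
move=> [_ Kx p0 p1] e0; have p0' i : 0 <= p i by exact/ltW.
have [mu [muK muE]] := discrete_PK cK Kx p0' p1.
by exists mu; apply: discrete_basic_self.
Qed.

Variable P : probability (measurableTypeR R) R.
Hypothesis PE : forall A : set R,
  P A = @lebesgue_measure R (A `&` `[0, 1]%classic).

(** The realization [st_S] is carried along with the discrete law because the next realization is
    coupled to it. *)
Record stage := Stage { st_I : finType; st_x : st_I -> Rd R d; st_p : st_I -> R;
  st_e : R; st_S : st_I -> set R }.

Definition st_nbhd s := basic_nbhd K (@st_x s) (@st_p s) (st_e s).

Definition valid_stage s := [/\ atoms K (@st_x s) (@st_p s), 0 < st_e s &
  realizes P (@st_p s) (@st_S s)].

Definition refines s s' := st_e s' <= st_e s / 2 /\
  exists G : set R, [/\ measurable (G : set (measurableTypeR R)),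
    1 - st_e s / 8 <= mass P (G : set (measurableTypeR R)) &
    forall t, G t -> exists (i : st_I s) (j : st_I s'),
      [/\ st_S i t, st_S j t & edist (st_x i) (st_x j) < st_e s / 8]].

(** The radius is shrunk before entering [Q]: a discrete law found in the smaller neighbourhood is
    so close to the old one that their coupling satisfies the bounds in [refines]. *)
Lemma refine_stage s (Q : set prob) : valid_stage s ->
  (forall U, weak_open K U -> U !=set0 -> U `<=` st_nbhd s ->
     exists W, [/\ weak_open K W, W !=set0, W `<=` U & W `<=` Q]) ->
  exists s', [/\ valid_stage s', st_nbhd s' `<=` st_nbhd s `&` Q & refines s s'].
Proof.
case: s => I x p e S [/= ap e0 rS] hQ.
have [xinj Kx p0 p1] := ap.
have [e1 e10 he1] := separated xinj.
pose N : R := #|I|%:R; have N0 : 0 < N + 1 by rewrite ltr_wpDl// /N ler0n.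
(* The first term gives the separation demanded by [couple_step]; the second bounds both its
   displacement [e2] and its exceptional mass [N * e2] by [e / 8]. *)
pose e2 := Num.min (e1 / 2) (e / 8 / (N + 1)).
have e20 : 0 < e2 by rewrite lt_min !divr_gt0.
have e2e1 : e2 + e2 <= e1.
  have h : e2 <= e1 / 2 by rewrite ge_min lexx.
  by lra.
have e2N : (N + 1) * e2 <= e / 8.
  by rewrite mulrC -ler_pdivlMr// ge_min lexx orbT.
have Ne20 : 0 <= N * e2 by rewrite mulr_ge0 ?ler0n// ltW.
have [||U|W [oW [mu Wmu] WU WQ]] := hQ (basic_nbhd K x p e2).
- exact: weak_open_basic.
- exact: atoms_basic_nonempty.
- by apply: basic_nbhd_le => /=; lra.
have [J [y [q [e3 [aq e30 e3W]]]]] := exists_basic_nbhd cK oW Wmu.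
have [yinj Ky q0 q1] := aq.
pose e4 := Num.min e3 (e / 2).
have e40 : 0 < e4 by rewrite lt_min e30 divr_gt0.
have e4W : basic_nbhd K y q e4 `<=` W.
  by apply: subset_trans e3W; apply: basic_nbhd_le; rewrite ge_min lexx.
have q0' j : 0 <= q j by exact/ltW.
have [nu [nuK nuE]] := discrete_PK cK Ky q0' q1.
have Wnu : W nu by apply: e4W; exact: discrete_basic_self.
have [||S' [G [rS' mG G_ge G_step]]] :=
  couple_step PE _ p1 q0' q1 _ (ltW e20) nuE (WU _ Wnu) rS.
- by move=> i; exact/ltW.
- by move=> i j ij; exact: le_trans e2e1 (he1 _ _ ij).
exists (@Stage J y q e4 S'); split; first by split.
- move=> nu' /e4W Wnu'; split; last exact: WQ.
  have := WU _ Wnu'; apply: basic_nbhd_le => /=; lra.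
- split => /=; first by rewrite ge_min lexx orbT.
  exists G; split=> //; first by apply: le_trans G_ge; rewrite -/N; lra.
  move=> t /G_step[i [j [it jt ij]]]; exists i, j; split=> //=.
  by lra.
Qed.

End BaireCategory.

(** * The Baire property of the space of measures *)

Section BaireTheorem.
Variables (R : realType) (d : nat) (K : set (Rd R d)).
Hypothesis cK : compact K.
Local Notation prob := (probability (BorelRd R d) R).
Implicit Types (mu nu : prob) (U V W : set prob).

(** Iterating [refine_stage] gives nested basic neighbourhoods in [U0], the one of index n+1 inside
    [Q n], with coupled realizations; the limit law belongs to all of them. *)
Theorem baire_weak (U0 : set prob) (Q : nat -> set prob) :
  weak_open K U0 -> U0 !=set0 ->
  (forall n U, weak_open K U -> U !=set0 -> U `<=` U0 ->
     exists W, [/\ weak_open K W, W !=set0, W `<=` U & W `<=` Q n]) ->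
  exists mu, U0 mu /\ forall n, Q n mu.
Proof.
move=> oU0 [mu0 U0mu0] hQ.
have [P PE] := exists_unit_lebesgue R.
have [I [x [p [e [ap e0 eU0]]]]] := exists_basic_nbhd cK oU0 U0mu0.
have [xinj Kx p0 p1] := ap.
have [||S [mS _ dS SE]] := atomless_partition PE (m := p) measurableT.
- by move=> i; exact/ltW.
- by rewrite p1 massT.
pose T := {s : stage R d | valid_stage K P s /\ st_nbhd K s `<=` U0}.
have vs0 : valid_stage K P (Stage x p e S) /\ st_nbhd K (Stage x p e S) `<=` U0.
  by split.
have /choice[next hnext] : forall ns : nat * T, exists s' : T,
    st_nbhd K (sval s') `<=` Q ns.1 /\ refines P (sval ns.2) (sval s').
  move=> [n [s [vs sU0]]] /=.
  have [|s' [vs' s'sub s's]] := refine_stage cK PE (Q := Q n) vs.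
    move=> U oU U_ne Us; apply: hQ => //; exact: subset_trans sU0.
  have s'U0 : st_nbhd K s' `<=` U0 by move=> nu /s'sub[/sU0].
  exists (exist _ s' (conj vs' s'U0)); split=> //= nu /s'sub[_].
  by [].
pose f := fix f n : T := if n is n'.+1 then next (n', f n') else exist _ _ vs0.
have fQ n : st_nbhd K (sval (f n.+1)) `<=` Q n by have [] := hnext (n, f n).
have fref n : refines P (sval (f n)) (sval (f n.+1)) by have [] := hnext (n, f n).
have fval n : valid_stage K P (sval (f n)) by have [] := proj2_sig (f n).
have /choice[G hG] : forall n, exists G : set R,
  [/\ measurable (G : set (measurableTypeR R)),
    1 - st_e (sval (f n)) / 8 <= mass P (G : set (measurableTypeR R)) &
    forall t, G t -> exists (i : st_I (sval (f n))) (j : st_I (sval (f n.+1))),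
      [/\ st_S i t, st_S j t & edist (st_x i) (st_x j) < st_e (sval (f n)) / 8]].
  by move=> n; have [_] := fref n.
have [i _] : exists i : I, True.
  apply: contrapT => hn; move: p1; rewrite big1; first by move/eqP; rewrite eq_sym oner_eq0.
  by move=> i; case: hn; exists i.
have [|||||||mu hmu] := @exists_limit_law R d K cK P (fun n => st_I (sval (f n)))
  (fun n => @st_x _ _ (sval (f n))) (fun n => @st_p _ _ (sval (f n)))
  (fun n => st_e (sval (f n))) (fun n => @st_S _ _ (sval (f n))) G (x i) (Kx i).
- by move=> n j; have [[]] := fval n.
- by move=> n; have [] := fval n.
- by move=> n; have [] := fref n.
- by move=> n; have [] := fval n.
- by move=> n; have [] := hG n.
- by move=> n; have [] := hG n.
- by move=> n; have [] := hG n.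
exists mu; split; first by have [_] := proj2_sig (f 0%N); apply; exact: hmu.
by move=> n; apply: (fQ n); exact: hmu.
Qed.

(** [G n] is the weak interior of [Q n]; by [baire_weak] the intersection of the [G n] meets every
    nonempty open set. *)
Lemma typical_forall (Q : nat -> set prob) :
  (forall n U, weak_open K U -> U !=set0 ->
     exists W, [/\ weak_open K W, W !=set0, W `<=` U & W `<=` Q n]) ->
  typical K (fun mu => forall n, Q n mu).
Proof.
move=> hQ; pose G n : set prob := [set mu | exists W, [/\ weak_open K W, W mu & W `<=` Q n]].
have oG n : weak_open K (G n).
  split=> [mu [W [[WP _] /WP]]//|mu [W [oW Wmu WQ]]].
  have [_ /(_ _ Wmu)[fs [eps [cfs [eps0 fsW]]]]] := oW.
  exists fs, eps; split=> //; split=> // nu /fsW Wnu.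
  by exists W.
exists G; split=> //; split.
  split=> [mu /(_ 0%N Logic.I) Gmu|]; first exact: (weak_open_sub (oG 0%N)).
  move=> U oU U0.
  have [|mu [Umu Gmu]] := @baire_weak U G oU U0.
    move=> n V oV V0 _; have [W [oW W0 WV WQ]] := hQ n V oV V0.
    by exists W; split=> // mu Wmu; exists W.
  by exists mu; split=> // n _; exact: Gmu.
by move=> mu h n; have [W [_ Wmu]] := h n Logic.I; exact.
Qed.

(** Density of the [Q' n] is required only below [U0]. Intersecting with the open sets [G n], whose
    intersection is dense, keeps open sets nonempty, so both families enter one application of
    [baire_weak]. *)
Lemma typical_meets (Q : prob -> Prop) (G : nat -> set prob) (U0 : set prob) :
  (forall n, weak_open K (G n)) -> weak_dense K (\bigcap_n G n) ->
  (forall mu, (\bigcap_n G n) mu -> Q mu) ->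
  forall Q' : nat -> set prob, weak_open K U0 -> U0 !=set0 ->
  (forall n U, weak_open K U -> U !=set0 -> U `<=` U0 ->
     exists W, [/\ weak_open K W, W !=set0, W `<=` U & W `<=` Q' n]) ->
  exists mu, [/\ U0 mu, Q mu & forall n, Q' n mu].
Proof.
move=> oG [_ dG] GQ Q' oU0 U00 hQ'.
have [|mu [U0mu h]] := baire_weak (Q := fun n => G n `&` Q' n) oU0 U00.
  move=> n U oU U_ne UU0; have [W [oW [nu Wnu] WU WQ]] := hQ' n U oU U_ne UU0.
  exists (W `&` G n); split.
  - exact: weak_openI.
  - have [|m [Gm Wm]] := dG W oW; first by exists nu.
    by exists m; split=> //; exact: Gm.
  - by move=> m [/WU].
  - by move=> m [/WQ].
exists mu; split=> // [|n]; last by have [] := h n.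
by apply: GQ => n _; have [] := h n.
Qed.

End BaireTheorem.

(** * Packing numbers of bounded sets *)

Section Packings.
Variables (R : realType) (d : nat).
Implicit Types (E : set (Rd R d)) (r : R) (n : nat).

Definition is_packing E r n := exists x : 'I_n -> Rd R d,
  (forall i, E (x i)) /\ (forall i j, i != j -> eball (x i) r `&` eball (x j) r = set0).

(** Centres of disjoint r-balls are 2r apart, so they occupy distinct cells of a fine grid; count
    the cells of a box containing E. *)
Lemma packing_count_bound E : (exists2 M : R, 0 < M &
    forall x, E x -> forall i, `|x ord0 i| <= M) ->
  exists2 C : R, 1 <= C & forall r n, 0 < r -> r < 1 -> is_packing E r n ->
    n%:R <= (C / r) ^+ d.
Proof.
move=> [M M0 EM]; pose D : R := d.+1%:R; have D0 : 0 < D by rewrite ltr0n.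
exists (2 * M * D + 1); first by rewrite lerDr !mulr_ge0// ltW.
move=> r n r0 r1 [x [Ex dx]].
(* With this mesh two points of one cell are at distance at most [d * h], below [2 * r]. *)
pose h := r / D; have h0 : 0 < h by rewrite divr_gt0.
pose m := Num.truncn (2 * M / h).
have m_itv := truncn_itv (ltW (divr_gt0 (mulr_gt0 (ltr0n R 2) M0) h0)).
pose cell i : {ffun 'I_d -> 'I_m.+1} :=
  [ffun c => inord (Num.truncn ((x i ord0 c + M) / h))].
have coord_itv i c : 0 <= (x i ord0 c + M) / h <= 2 * M / h.
  have := EM _ (Ex i) c; rewrite ler_norml => /andP[? ?].
  by rewrite divr_ge0 ?(ltW h0)//=; [rewrite ler_pM2r ?invr_gt0//; lra|lra].
have cell_inj : injective cell.
  move=> i j ij; apply/eqP; apply: contraT => /dx/disjoint_eballs.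
  rewrite leNgt => /negP; case; apply: (@le_lt_trans _ _ (d%:R * h)).
    apply: edist_le_coord; first exact: ltW.
    move=> c; move/ffunP : ij => /(_ c); rewrite !ffunE => /(congr1 val) /=.
    have bnd k : (Num.truncn ((x k ord0 c + M) / h) < m.+1)%N.
      have /andP[ck0 ck] := coord_itv k c.
      rewrite truncn_lt_nat//; apply: le_lt_trans ck _.
      by move: m_itv => /andP[].
    rewrite !inordK// => tE.
    have /andP[i0 _] := coord_itv i c; have /andP[j0 _] := coord_itv j c.
    have /andP[i1 i2] := truncn_itv i0; have := truncn_itv j0.
    rewrite -tE => /andP[j1 j2].
    rewrite ler_norml; move: i1 i2 j1 j2.
    rewrite !(ler_pdivlMr _ _ h0) !(ltr_pdivrMr _ _ h0) -!natr1.
    by move: (Num.truncn _)%:R => t *; apply/andP; split; lra.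
  rewrite /h mulrA ltr_pdivrMr//; have : d%:R < D by rewrite ltr_nat.
  by have : 0 <= d%:R :> R by []; nra.
have := leq_card cell cell_inj; rewrite card_ord card_ffun !card_ord => nm.
apply: (@le_trans _ _ ((m.+1 ^ d)%N%:R)); first by rewrite ler_nat.
rewrite natrX lerXn2r ?nnegrE//; first by rewrite divr_ge0 ?(ltW r0)// addr_ge0// !mulr_ge0// ltW.
rewrite -natr1 ler_pdivlMr// mulrDl mul1r; apply: lerD; last exact: ltW.
move: m_itv => /andP[+ _]; rewrite -/m /h ler_pdivlMr// => hm.
by rewrite -ler_pdivrMr// -mulrA.
Qed.

Lemma is_packing_sub E E' r n : E `<=` E' -> is_packing E r n -> is_packing E' r n.
Proof. by move=> EE' [x [Ex dx]]; exists x; split=> // i; exact/EE'/Ex. Qed.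

(** A point at distance at least 2r from all centres could be added to the packing. *)
Lemma max_packing_cover E r n (x : 'I_n -> Rd R d) : 0 < r ->
  (forall i, E (x i)) -> (forall i j, i != j -> eball (x i) r `&` eball (x j) r = set0) ->
  ~ is_packing E r n.+1 -> forall y, E y -> exists i, edist (x i) y < 2 * r.
Proof.
move=> r0 Ex dx hn y Ey; apply: contrapT => /forallNP far; apply: hn.
exists (fun i => oapp x y (unlift ord_max i)); split.
  by move=> i; case: unliftP => [j|] _ //=.
have dxy i : eball (x i) r `&` eball y r = set0.
  by apply: eball_disjoint; have := far i; move/negP; rewrite -leNgt; lra.
move=> i j ij; move: ij; case: (unliftP ord_max i) => [i' ->|->];
  case: (unliftP ord_max j) => [j' ->|->] //=.
- by move=> ij; apply: dx; apply: contraNneq ij => ->.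
- by rewrite setIC.
- by rewrite eqxx.
Qed.

Definition log_packing E r : R := fine (elog (packing E r)).

(** Packings have bounded size, so the supremum is attained, and a largest packing is both
    2r-separated and 2r-dense: separation serves the lower entropy bounds, density the upper
    ones. *)
Lemma packing_spec E r : (exists2 M : R, 0 < M &
    forall x, E x -> forall i, `|x ord0 i| <= M) -> E !=set0 -> 0 < r -> r < 1 ->
  exists n, [/\ (0 < n)%N, packing E r = (n%:R)%:E, log_packing E r = ln n%:R,
    elog (packing E r) = (log_packing E r)%:E &
    exists x : 'I_n -> Rd R d, [/\ (forall i, E (x i)),
      (forall i j, i != j -> 2 * r <= edist (x i) (x j)) &
      (forall y, E y -> exists i, edist (x i) y < 2 * r)]].
Proof.
move=> bE [z Ez] r0 r1; have [C C1 hC] := packing_count_bound bE.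
have hub n : `[< is_packing E r n >] -> (n <= Num.truncn ((C / r) ^+ d))%N.
  move=> /asboolP /(hC _ _ r0 r1) nC; have C0 : 0 <= (C / r) ^+ d.
    by rewrite exprn_ge0// divr_ge0 ?(ltW r0)// (le_trans ler01).
  by rewrite -ltnS -(ltr_nat R); move: (truncn_itv C0) => /andP[_]; exact: le_lt_trans.
have hex : exists n, `[< is_packing E r n >].
  exists 1%N; apply/asboolP; exists (fun=> z); split=> // i j.
  by rewrite !ord1 eqxx.
case: (ex_maxnP hex hub) => n /asboolP [x [Ex dx]] n_max.
have n0 : (0 < n)%N.
  apply: n_max; apply/asboolP; exists (fun=> z); split=> // i j.
  by rewrite !ord1 eqxx.
have pE : packing E r = (n%:R)%:E.
  apply/eqP; rewrite eq_le; apply/andP; split.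
    apply: ge_ereal_sup => _ [m pm <-]; rewrite lee_fin ler_nat.
    by apply: n_max; apply/asboolP.
  by apply: ereal_sup_ubound; exists n => //; exists x.
exists n; rewrite /log_packing pE /= ltr0n n0; split=> //.
exists x; split=> // [i j ij|]; first exact/disjoint_eballs/dx.
apply: max_packing_cover => // h.
by move/asboolP : h => /n_max; rewrite ltnn.
Qed.

Lemma log_packing_ge0 E r : (exists2 M : R, 0 < M &
    forall x, E x -> forall i, `|x ord0 i| <= M) -> E !=set0 -> 0 < r -> r < 1 ->
  0 <= log_packing E r.
Proof.
move=> bE E0 r0 r1; have [n [n0 _ -> _ _]] := packing_spec bE E0 r0 r1.
by rewrite ln_ge0// ler1n.
Qed.

Lemma log_packing_le E E' r : (exists2 M : R, 0 < M &
    forall x, E' x -> forall i, `|x ord0 i| <= M) -> E `<=` E' -> E !=set0 ->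
  0 < r -> r < 1 -> log_packing E r <= log_packing E' r.
Proof.
move=> bE' EE' E0 r0 r1; have E'0 : E' !=set0 by case: E0 => z /EE'; exists z.
have bE : exists2 M : R, 0 < M & forall x, E x -> forall i, `|x ord0 i| <= M.
  by case: bE' => M M0 hM; exists M => // x /EE'; exact: hM.
have [n [n0 pE -> _ _]] := packing_spec bE E0 r0 r1.
have [n' [n'0 pE' -> _ _]] := packing_spec bE' E'0 r0 r1.
rewrite ler_ln ?posrE ?ltr0n// -lee_fin -pE -pE'.
apply: le_ereal_sup => _ [m [x [Ex dx]] <-]; exists m => //.
by exists x; split=> // i; exact/EE'/Ex.
Qed.

(** The price of a unit of mass about whose location nothing is known: at most [d] times -log r, up
    to a constant. *)
Lemma log_packing_bound E : (exists2 M : R, 0 < M &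
    forall x, E x -> forall i, `|x ord0 i| <= M) -> E !=set0 ->
  exists2 C : R, 0 <= C & forall r, 0 < r -> r < 1 ->
    log_packing E r <= d%:R * (C - ln r).
Proof.
move=> bE E0; have [C C1 hC] := packing_count_bound bE.
exists (ln C); first exact: ln_ge0.
move=> r r0 r1; have C0 : 0 < C by exact: lt_le_trans C1.
have Cr0 : 0 < C / r by rewrite divr_gt0.
have [n [n0 pE -> _ [x [Ex dx _]]]] := packing_spec bE E0 r0 r1.
rewrite -lnV ?posrE// -lnM ?posrE ?invr_gt0// mulr_natl -lnXn//.
rewrite ler_ln ?posrE ?ltr0n ?exprn_gt0//; apply: hC => //.
exists x; split=> // i j ij; apply: eball_disjoint.
by have := dx _ _ ij; lra.
Qed.

End Packings.

(** * Entropy of a measure at scale r *)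

Section BallEntropy.
Variables (R : realType) (d : nat) (K : set (Rd R d)).
Hypothesis cK : compact K.
Local Notation prob := (probability (BorelRd R d) R).
Local Notation meas A := (measurable (A : set (BorelRd R d))).
Implicit Types (mu nu : prob) (A B : set (Rd R d)).

Lemma open_of_eball A :
  (forall x, A x -> exists2 r, 0 < r & eball x r `<=` A) -> open A.
Proof. by move=> h; rewrite openE => x /h ?; apply/nbhs_eball. Qed.

(** The sign makes the integrand nonnegative, so that integrals are monotone in domain and
    integrand; null balls give +oo. *)
Definition log_loss mu (r : R) (x : Rd R d) : \bar R :=
  (- elog (mu (eball x r : set (BorelRd R d))))%E.

Lemma log_lossE mu r x : log_loss mu r x =
  if 0 < mass mu (eball x r) then (- ln (mass mu (eball x r)))%:E else +oo%E.
Proof.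
by rewrite /log_loss massE; [rewrite /=; case: ifP|exact: eball_measurable].
Qed.

Lemma log_loss_ge0 mu r x : (0 <= log_loss mu r x)%E.
Proof.
rewrite log_lossE; case: ifP => [m0|_]; last exact: leey.
rewrite lee_fin oppr_ge0 ln_le0//; apply: mass_le1; exact: eball_measurable.
Qed.

Lemma log_loss_le mu r x (t : R) : 0 < t -> t <= mass mu (eball x r) ->
  (log_loss mu r x <= (- ln t)%:E)%E.
Proof.
move=> t0 tm; rewrite log_lossE (lt_le_trans t0 tm) lee_fin lerN2.
by rewrite ler_ln// posrE// (lt_le_trans t0).
Qed.

Lemma log_loss_ge mu r x (t : R) : 0 < t -> mass mu (eball x r) <= t ->
  ((- ln t)%:E <= log_loss mu r x)%E.
Proof.
move=> t0 tm; rewrite log_lossE; case: ifP => [m0|_]; last exact: leey.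
by rewrite lee_fin lerN2 ler_ln// posrE.
Qed.

(* x |-> mu (B(x, r)) is lower semicontinuous *)
Lemma measurable_mass_eball mu (r : R) :
  measurable_fun setT (fun x : BorelRd R d => mass mu (eball x r)).
Proof.
apply: (measurability _ (RGenOInfty.measurableE R)) => _ [_ [a ->] <-].
rewrite setTI; apply: open_BorelRd; apply: open_of_eball => x /=.
rewrite in_itv /= andbT => /mass_eball_inner[e' e'r ae'].
exists (r - e'); first by rewrite subr_gt0.
move=> y; rewrite /eball /= in_itv /= andbT => xy; apply: lt_le_trans ae' _.
apply: mass_le; [exact: eball_measurable|exact: eball_measurable|].
by apply: le_eball; rewrite edist_sym; lra.
Qed.

Lemma measurable_log_loss mu r A :
  measurable_fun (A : set (BorelRd R d)) (log_loss mu r : BorelRd R d -> \bar R).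
Proof.
apply: measurable_funTS.
rewrite (_ : (log_loss mu r : BorelRd R d -> \bar R) = (fun x : BorelRd R d =>
  if 0 < mass mu (eball x r) then (- ln (mass mu (eball x r)))%:E else +oo%E)).
  have mm := measurable_mass_eball mu r.
  apply: measurable_fun_ifT => //.
    by apply: measurable_fun_ltr.
  apply/measurable_EFinP; apply: measurableT_comp => //.
  exact: measurableT_comp (@measurable_ln R) mm.
by apply/funext => x; rewrite log_lossE.
Qed.

Definition entropy mu r : R :=
  fine (\int[mu]_(x in (K : set (BorelRd R d))) log_loss mu r x)%E.

(** For x in [A] the ball B(x,r) contains all of [A]. *)
Lemma integral_cell mu r A : meas A ->
  (forall x y, A x -> A y -> edist x y < r) ->
  (\int[mu]_(x in (A : set (BorelRd R d))) log_loss mu r x <=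
     (- mass mu A * ln (mass mu A))%:E)%E.
Proof.
move=> mA dA.
have hle : (\int[mu]_(x in (A : set (BorelRd R d))) log_loss mu r x <=
    \int[mu]_(x in (A : set (BorelRd R d)))
       (cst (if (0 < mass mu A)%R then (- ln (mass mu A))%:E else +oo)) x)%E.
  apply: ge0_le_integral => //.
  - by move=> x _; exact: log_loss_ge0.
  - exact: measurable_log_loss.
  - move=> x Ax /=; case: ifP => [m0|_]; last exact: leey.
    apply: log_loss_le => //; apply: mass_le => //; first exact: eball_measurable.
    by move=> y Ay; rewrite /eball /=; exact: dA.
apply: le_trans hle _; rewrite integral_cst// [X in (_ * X)%E](massE mu mA).
case: ifPn => [m0|]; first by rewrite -EFinM mulNr mulrC mulNr.
rewrite -leNgt => m0; have -> : mass mu A = 0.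
  by apply/eqP; rewrite eq_le m0 mass_ge0.
by rewrite oppr0 mul0r mule0.
Qed.

(* Gibbs: -m ln m <= m ln n + (1/n - m), from ln x <= x - 1 at x = 1/(nm) *)
Lemma gibbs_le (m : R) (n : nat) : 0 <= m -> (0 < n)%N ->
  - m * ln m <= m * ln n%:R + (n%:R^-1 - m).
Proof.
rewrite le_eqVlt => /predU1P[<-|m0] n0.
  by rewrite oppr0 !mul0r add0r addr0 invr_ge0.
have n0' : 0 < n%:R :> R by rewrite ltr0n.
have nm0 : 0 < n%:R^-1 / m by rewrite divr_gt0// invr_gt0.
have : ln (n%:R^-1 / m) <= n%:R^-1 / m - 1.
  rewrite -[X in ln X](subrKC 1) le_ln1Dx//.
  by move: nm0; set v := _ / m; lra.
rewrite lnM ?posrE ?invr_gt0// !lnV ?posrE//.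
rewrite -(ler_pM2l m0) !mulrBr mulr1 [m * (_ / m)]mulrC divfK ?gt_eqF//.
by rewrite mulrN mulNr; move: (n%:R^-1) => v; lra.
Qed.

(** Split [A] into cells, each inside one ball of radius r/2 and hence of diameter below r, and sum
    [gibbs_le]: its correction terms add up to 1 - mu(A). *)
Lemma integral_covered mu r A (s : seq (Rd R d)) : meas A ->
  (forall x, A x -> exists2 c, c \in s & edist c x < r / 2) ->
  (\int[mu]_(x in (A : set (BorelRd R d))) log_loss mu r x <=
     (mass mu A * ln (size s)%:R + 1)%:E)%E.
Proof.
move=> mA As; have mb := @eball_measurable R d.
pose F k := eball (nth 0 s k) (r / 2).
pose C (k : 'I_(size s)) := A `&` seqDU F k.
have mC k : meas (C k).
  apply: measurableI => //; apply: measurableD; first exact: mb.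
  by apply: bigsetU_measurable => *; exact: mb.
have dC i j : i != j -> C i `&` C j = set0.
  move=> ij; have /trivIsetP/(_ i j Logic.I Logic.I ij) h := @trivIset_seqDU _ F.
  by rewrite /C setIACA h setI0.
have CA : \big[setU/set0]_(i < size s) C i = A.
  apply/seteqP; split=> x.
    by rewrite -bigcup_seq => -[k _ []].
  move=> Ax; have [c cs cx] := As _ Ax.
  have : (\big[setU/set0]_(k < size s) seqDU F k) x.
    rewrite -bigsetU_seqDU -bigcup_mkord; exists (index c s); first by rewrite /= index_mem.
    by rewrite /F nth_index.
  rewrite -!bigcup_seq => -[k ks kx]; exists k => //.
rewrite -[in leLHS]CA ge0_integral_bigsetU//; first last.
- by move=> x _; exact: log_loss_ge0.
- exact: measurable_log_loss.
- by apply/trivIsetP => i j _ _ ij; exact: dC.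
- exact: index_enum_uniq.
apply: (@le_trans _ _ (\sum_(k < size s) (- mass mu (C k) * ln (mass mu (C k)))%:E)%E).
  apply: lee_sum => k _; apply: integral_cell => // x y [_ [Fx _]] [_ [Fy _]].
  have := edist_triangle (nth 0 s k) x y; rewrite (edist_sym x (nth 0 s k)).
  by move: Fx Fy; rewrite /F /eball /=; lra.
rewrite sumEFin lee_fin.
(* Without centres the sum is empty, and [ln 0] is 0 by convention. *)
have [s0|s0] := posnP (size s).
  rewrite big1 => [|[k ks] _]; last by have := ks; rewrite [X in (_ < X)%N]s0.
  by rewrite s0 ln0// mulr0 add0r.
apply: (@le_trans _ _ (\sum_(k < size s) (mass mu (C k) * ln (size s)%:R +
    ((size s)%:R^-1 - mass mu (C k))))).
  by apply: ler_sum => k _; apply: gibbs_le => //; exact: mass_ge0.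
rewrite big_split /= -mulr_suml sumrB sumr_const card_ord.
have -> : \sum_(k < size s) mass mu (C k) = mass mu A by rewrite sum_mass// CA.
rewrite -[(size s)%:R^-1 *+ _]mulr_natr mulVf ?pnatr_eq0 -?lt0n//.
by rewrite lerD2l gerBl mass_ge0.
Qed.

Lemma integral_log_loss_ge0 mu r A :
  (0 <= \int[mu]_(x in (A : set (BorelRd R d))) log_loss mu r x)%E.
Proof. by apply: integral_ge0 => x _; exact: log_loss_ge0. Qed.

Lemma entropy_fin mu r : 0 < r ->
  (\int[mu]_(x in (K : set (BorelRd R d))) log_loss mu r x)%E = (entropy mu r)%:E.
Proof.
move=> r0; rewrite /entropy fineK// ge0_fin_numE ?integral_log_loss_ge0//.
have [s [_ hs]] := @compact_eball_cover R d K (fun=> r / 2) cK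
  (fun _ _ => divr_gt0 r0 (ltr0n _ 2)).
apply: le_lt_trans (@integral_covered mu r K s (measK cK) _) _; last exact: ltry.
by move=> x /hs.
Qed.

Lemma entropy_ge0 mu r : 0 <= entropy mu r.
Proof. by rewrite /entropy fine_ge0// integral_log_loss_ge0. Qed.

Lemma DquotE mu r : 0 < r -> Dquot K mu r = (entropy mu r / - ln r)%:E.
Proof.
move=> r0; rewrite /Dquot.
have -> : (\int[mu]_(x in (K : set (BorelRd R d)))
    elog (mu (eball x r : set (BorelRd R d))))%E = (- entropy mu r)%:E.
  rewrite EFinN -entropy_fin// -integral_ge0N; last by move=> x _; exact: log_loss_ge0.
  by apply: eq_integral => x _; rewrite /log_loss oppeK.
by rewrite -EFinM invrN mulrN mulNr.
Qed.

(** Use [integral_covered] on each [A i] with its own cover and on the remainder with the cover [s0]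
    of [K]; every use costs an additive 1. *)
Lemma entropy_upper mu r (I : finType) (A : I -> set (Rd R d))
    (s : I -> seq (Rd R d)) (s0 : seq (Rd R d)) : PK K mu -> 0 < r ->
  (forall i, meas (A i)) -> (forall i j, i != j -> A i `&` A j = set0) ->
  (forall i x, K x -> A i x -> exists2 c, c \in s i & edist c x < r / 2) ->
  (forall x, K x -> exists2 c, c \in s0 & edist c x < r / 2) ->
  entropy mu r <= \sum_i mass mu (A i) * ln (size (s i))%:R +
    (1 - \sum_i mass mu (A i)) * ln (size s0)%:R + #|I|%:R + 1.
Proof.
move=> muK r0 mA dA hs hs0; have mK := measK cK.
have K1 : mass mu K = 1 by rewrite /mass muK.
pose B i := K `&` A i.
have mB i : meas (B i) by exact: measurableI.
have dB i j : i != j -> B i `&` B j = set0.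
  by move=> ij; rewrite /B setIACA dA// setI0.
have massB i : mass mu (B i) = mass mu (A i) by rewrite PK_massI.
set D := \big[setU/set0]_i B i.
have mD : meas D by exact: bigsetU_measurable.
have DK : D `<=` K by move=> x; rewrite /D -bigcup_seq => -[i _] [].
have mKD : meas (K `\` D) by exact: measurableD.
have KE : D `|` (K `\` D) = K by rewrite setDUK.
have massD : mass mu D = \sum_i mass mu (A i).
  by rewrite -sum_mass//; apply: eq_bigr => i _; rewrite massB.
have massKD : mass mu (K `\` D) = 1 - \sum_i mass mu (A i).
  by rewrite -massD -K1 -[in mass mu K]KE massU// ?setDIK// addrC addKr.
rewrite -lee_fin -entropy_fin// -[in leLHS]KE ge0_integral_setU//; first last.
- by rewrite disj_set2E setDIK.
- by move=> x _; exact: log_loss_ge0.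
- exact: measurable_log_loss.
have -> : (\sum_i mass mu (A i) * ln (size (s i))%:R +
    (1 - \sum_i mass mu (A i)) * ln (size s0)%:R + #|I|%:R + 1)%:E =
  (\sum_i (mass mu (B i) * ln (size (s i))%:R + 1)%:E +
   (mass mu (K `\` D) * ln (size s0)%:R + 1)%:E)%E.
  rewrite sumEFin big_split /= sumr_const massKD -EFinD; congr EFin.
  under [in RHS]eq_bigr do rewrite massB.
  by rewrite !addrA [in LHS](addrAC _ _ #|I|%:R).
apply: leeD; last first.
  by apply: integral_covered => // x [Kx _]; exact: hs0.
rewrite /D ge0_integral_bigsetU//; first last.
- by move=> x _; exact: log_loss_ge0.
- exact: measurable_log_loss.
- by apply/trivIsetP => i j _ _ ij; exact: dB.
- exact: index_enum_uniq.
by apply: lee_sum => i _; apply: integral_covered => // x [Kx Ax]; exact: hs Ax.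
Qed.

Lemma entropy_lower mu r (J : finType) (B : J -> set (Rd R d)) (t : J -> R) :
  PK K mu -> 0 < r -> (forall j, meas (B j)) ->
  (forall i j, i != j -> B i `&` B j = set0) -> (forall j, 0 < t j) ->
  (forall j x, B j x -> mass mu (eball x r) <= t j) ->
  \sum_j mass mu (B j) * (- ln (t j)) <= entropy mu r.
Proof.
move=> muK r0 mB dB t0 hB; have mK := measK cK.
pose C j := K `&` B j.
have mC i : meas (C i) by exact: measurableI.
have dC i j : i != j -> C i `&` C j = set0.
  by move=> ij; rewrite /C setIACA dB// setI0.
set D := \big[setU/set0]_i C i.
have mD : meas D by exact: bigsetU_measurable.
have DK : D `<=` K by move=> x; rewrite /D -bigcup_seq => -[i _] [].
rewrite -lee_fin -entropy_fin//.
apply: (@le_trans _ _ (\int[mu]_(x in (D : set (BorelRd R d))) log_loss mu r x)%E);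
  last first.
  apply: ge0_subset_integral => //; first exact: measurable_log_loss.
  by move=> x _; exact: log_loss_ge0.
rewrite /D ge0_integral_bigsetU//; first last.
- by move=> x _; exact: log_loss_ge0.
- exact: measurable_log_loss.
- by apply/trivIsetP => i j _ _ ij; exact: dC.
- exact: index_enum_uniq.
rewrite -sumEFin; apply: lee_sum => j _.
(* [t j] may exceed 1; its term is then nonpositive, and nonnegativity of the integrand suffices. *)
have [lt0|lt0] := leP 0 (- ln (t j)); last first.
  apply: (@le_trans _ _ 0%E); last exact: integral_log_loss_ge0.
  by rewrite lee_fin mulr_ge0_le0// ?mass_ge0// ltW.
rewrite -(PK_massI cK muK (mB j)) mulrC EFinM -(massE mu (mC j)) -integral_cst//.
apply: ge0_le_integral => //.
- exact: measurable_log_loss.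
- by move=> x [_ Bx]; apply: log_loss_ge => //; exact: hB Bx.
Qed.

End BallEntropy.

(** * Upper and lower limits at 0 *)

Section Limits0.
Variable R : realType.
Implicit Types (g : R -> \bar R) (c : \bar R).

Lemma limsup0_le g c (e : R) : 0 < e ->
  (forall r, 0 < r -> r < e -> (g r <= c)%E) -> (limsup0 g <= c)%E.
Proof.
move=> e0 h; apply: (@le_trans _ _ (ereal_sup (g @` [set r | 0 < r < e]))).
  by apply: ereal_inf_lbound; exists e.
by apply: ge_ereal_sup => _ [r /andP[r0 re] <-]; exact: h.
Qed.

Lemma limsup0_lt g c : (limsup0 g < c)%E ->
  exists2 e : R, 0 < e & forall r, 0 < r -> r < e -> (g r < c)%E.
Proof.
move=> /ereal_inf_lt[_ [e e0 <-] h]; exists e => // r r0 re.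
by apply: le_lt_trans h; apply: ereal_sup_ubound; exists r => //; apply/andP.
Qed.

Lemma limsup0_gt g c (e : R) : (c < limsup0 g)%E -> 0 < e ->
  exists r, [/\ 0 < r, r < e & (c < g r)%E].
Proof.
move=> cg e0; have : (c < ereal_sup (g @` [set r | (0 < r < e)%R]))%E.
  by apply: lt_le_trans cg _; apply: ereal_inf_lbound; exists e.
by move=> /ereal_sup_gt[_ [r /andP[r0 re] <-] h]; exists r.
Qed.

Lemma limsup0_ge g c :
  (forall e : R, 0 < e -> exists r, [/\ 0 < r, r < e & (c <= g r)%E]) ->
  (c <= limsup0 g)%E.
Proof.
move=> h; apply: le_ereal_inf_tmp => _ [e e0 <-].
have [r [r0 re cg]] := h e e0; apply: le_trans cg _.
by apply: ereal_sup_ubound; exists r => //; apply/andP.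
Qed.

Lemma liminf0_eq0 g : (forall r, 0 < r -> r < 1 -> (0 <= g r)%E) ->
  (forall e : R, 0 < e -> exists r, [/\ 0 < r, r < e & (g r <= e%:E)%E]) ->
  liminf0 g = 0%E.
Proof.
move=> g0 h; apply/eqP; rewrite eq_le; apply/andP; split.
  apply: ge_ereal_sup => _ [e e0 <-]; apply/lee_addgt0Pr => e' e'0.
  have e''0 : 0 < Num.min e e' by rewrite lt_min e0.
  have [r [r0 re gr]] := h _ e''0; rewrite add0e.
  apply: (@le_trans _ _ (g r)).
    apply: ereal_inf_lbound; exists r => //; rewrite /= r0 (lt_le_trans re)//.
    by rewrite ge_min lexx.
  by apply: le_trans gr _; rewrite lee_fin ge_min lexx orbT.
apply: (@le_trans _ _ (ereal_inf (g @` [set r | 0 < r < 1]))).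
  by apply: le_ereal_inf_tmp => _ [r /andP[r0 r1] <-]; exact: g0.
by apply: ereal_sup_ubound; exists 1 => //=.
Qed.

Lemma exists_small_radius (a M : R) : 0 < a ->
  exists r, [/\ 0 < r, r < a, r < 1 & M <= - ln r].
Proof.
move=> a0; pose r := Num.min (a / 2) (Num.min 2^-1 (expR (- M))).
have r0 : 0 < r by rewrite !lt_min divr_gt0// invr_gt0 ltr0n expR_gt0.
have ra : r <= a / 2 by rewrite ge_min lexx.
have r1 : r <= 2^-1 by rewrite !ge_min lexx orbT.
have rM : r <= expR (- M) by rewrite !ge_min lexx !orbT.
exists r; split; [by []|lra|lra|].
by rewrite lerNr -(expRK (- M)) ler_ln ?posrE// expR_gt0.
Qed.

Lemma Nln_gt (r M : R) : 0 < r -> r < expR (- M) -> M < - ln r.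
Proof. by move=> r0 rM; rewrite ltrNr -(expRK (- M)) ltr_ln ?posrE// expR_gt0. Qed.

End Limits0.

(** * Small entropy near discrete measures *)

Section DimensionBounds.
Variables (R : realType) (d : nat) (K : set (Rd R d)).
Hypothesis cK : compact K.
Local Notation prob := (probability (BorelRd R d) R).
Implicit Types (mu nu : prob) (U V W : set prob) (r : R).

Lemma sub_coord_bounded (E : set (Rd R d)) : E `<=` K -> exists2 M : R, 0 < M &
  forall x, E x -> forall i, `|x ord0 i| <= M.
Proof.
by have [M M0 hM] := compact_coord_bounded cK => EK; exists M => // x /EK; exact: hM.
Qed.

(** A largest packing at scale r/4 is r/2-dense. The change of scale later costs only a [ln 4]. *)
Lemma packing_cover (E : set (Rd R d)) r : E `<=` K -> E !=set0 -> 0 < r -> r < 1 ->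
  exists s : seq (Rd R d), ln (size s)%:R = log_packing E (r / 4) /\
    forall x, E x -> exists2 c, c \in s & edist c x < r / 2.
Proof.
move=> EK E0 r0 r1; have r40 : 0 < r / 4 by rewrite divr_gt0.
have r41 : r / 4 < 1 by lra.
have [n [_ _ lE _ [x [_ _ cov]]]] := packing_spec (sub_coord_bounded EK) E0 r40 r41.
exists (codom x); rewrite size_codom card_ord lE; split=> // y /cov[i iy].
exists (x i); first exact: codom_f.
by have -> : r / 2 = 2 * (r / 4) by field.
Qed.

Lemma Dquot_ge0 mu r : 0 < r -> r < 1 -> (0 <= Dquot K mu r)%E.
Proof.
move=> r0 r1; rewrite DquotE// lee_fin divr_ge0 ?entropy_ge0//.
by rewrite oppr_ge0 ln_le0// ltW.
Qed.

(** The order of choices matters: first a scale r tiny for the given atoms, then a neighbourhood so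
    small relative to r that almost all mass lies in the balls B(x_i,r/2). Each of these is covered
    by its own centre and contributes [ln 1 = 0]. *)
Lemma dense_lower_entropy U (e : R) : weak_open K U -> U !=set0 -> 0 < e ->
  exists W, [/\ weak_open K W, W !=set0, W `<=` U &
    forall nu, W nu -> exists r, [/\ 0 < r, r < e & (Dquot K nu r <= e%:E)%E]].
Proof.
move=> oU [mu0 Umu0] e0.
have [I [x [p [e1 [ap e10 e1U]]]]] := exists_basic_nbhd cK oU Umu0.
have [xinj Kx p0 p1] := ap.
have [e2 e20 he2] := separated xinj.
pose N : R := #|I|%:R; have N0 : 0 <= N by rewrite ler0n.
(* The entropy will be at most [N + 2]: the additive [N + 1] of [entropy_upper], and 1 for the mass
   outside the balls. *)
have [|r [r0 rmin r1 rM]] := @exists_small_radius R (Num.min e e2) ((N + 2) / e).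
  by rewrite lt_min e0.
have {rmin}[re re2] : r < e /\ r < e2.
  by move: rmin; rewrite lt_min => /andP.
have K0 : K !=set0.
  have [i _] : exists i : I, True.
    apply: contrapT => hn; move: p1; rewrite big1; first by move/eqP; rewrite eq_sym oner_eq0.
    by move=> i; case: hn; exists i.
  by exists (x i).
have [s0 [s0E s0K]] := packing_cover (@subset_refl _ K) K0 r0 r1.
pose L := ln (size s0)%:R : R.
have L0 : 0 <= L.
  by rewrite /L s0E log_packing_ge0//; [exact: sub_coord_bounded|lra|lra].
have NL0 : 0 < N * L + 1 by rewrite ltr_wpDl// mulr_ge0.
pose e3 := Num.min (Num.min e1 (r / 2)) (N * L + 1)^-1.
have e30 : 0 < e3 by rewrite !lt_min e10 divr_gt0// invr_gt0.
have e3r : e3 <= r / 2 by rewrite !ge_min lexx orbT.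
have e3e1 : e3 <= e1 by rewrite !ge_min lexx.
have e3L : e3 * (N * L) <= 1.
  have : e3 <= (N * L + 1)^-1 by rewrite ge_min lexx orbT.
  rewrite -[leRHS]div1r ler_pdivlMr// mulrDr mulr1; lra.
exists (basic_nbhd K x p e3); split.
- exact: weak_open_basic.
- exact: atoms_basic_nonempty.
- by apply: subset_trans e1U; exact: basic_nbhd_le.
move=> nu [nuK hnu]; exists r; split=> //.
rewrite DquotE// lee_fin.
have M0 : 0 < (N + 2) / e by rewrite divr_gt0//; lra.
have lnr0 : 0 < - ln r by exact: lt_le_trans rM.
rewrite ler_pdivrMr//; apply: (@le_trans _ _ (N + 2)); last first.
  by rewrite -ler_pdivrMl// mulrC.
have mb := @eball_measurable R d.
have := @entropy_upper R d K cK nu r I (fun i => eball (x i) (r / 2))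
  (fun i => [:: x i]) s0 nuK r0 _ _ _ s0K.
rewrite -/L /= -/N big1 ?add0r => [|i _]; last by rewrite ln1 mulr0.
have mass_ge : 1 - \sum_i mass nu (eball (x i) (r / 2)) <= N * e3.
  rewrite -[X in X - _]p1 -sumrB (@le_trans _ _ (\sum_(i : I) e3))//.
    apply: ler_sum => i _; have := hnu i.
    have : mass nu (eball (x i) e3) <= mass nu (eball (x i) (r / 2)).
      by apply: mass_le => //; apply: le_eball; rewrite edistxx add0r.
    by lra.
  by rewrite sumr_const -mulr_natl.
have : (1 - \sum_i mass nu (eball (x i) (r / 2))) * L <= 1.
  by apply: le_trans (ler_wpM2r L0 mass_ge) _; move: e3L; rewrite mulrCA mulrA.
move=> h1 h2; apply: le_trans (h2 _ _ _) _.
- by move=> i; exact: mb.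
- move=> i j ij; apply: eball_disjoint; apply: le_trans (he2 _ _ ij); lra.
- by move=> i y _ xy; exists (x i); rewrite ?mem_head.
- by lra.
Qed.

(** [conv_ubox] admits repeated points, whereas disjoint balls need distinct ones; adding up the
    weights of equal points changes no weighted sum. *)
Lemma merge_atoms (I : finType) (x : I -> Rd R d) (p : I -> R) :
  (forall i, 0 < p i) ->
  exists (J : finType) (y : J -> Rd R d) (q : J -> R),
    [/\ injective y, (forall j, exists i, y j = x i), (forall j, 0 < q j) &
      forall F : Rd R d -> R, \sum_i p i * F (x i) = \sum_j q j * F (y j)].
Proof.
move=> p0; pose s := undup (codom x).
have xs i : x i \in s by rewrite mem_undup codom_f.
pose J := 'I_(size s); pose y (j : J) := nth 0 s j.
have yinj : injective y.
  move=> j k /eqP; rewrite nth_uniq ?undup_uniq//.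
  by move=> /eqP/val_inj.
have yx j : exists i, y j = x i.
  have : y j \in s by exact: mem_nth.
  by rewrite mem_undup => /codomP[i ->]; exists i.
exists J, y, (fun j => \sum_(i | x i == y j) p i); split=> //.
  move=> j; have [i yi] := yx j; rewrite (bigD1 i) ?yi ?eqxx//=.
  by rewrite ltr_pwDl// sumr_ge0// => *; exact: ltW.
move=> F; pose h i : J := Ordinal (etrans (index_mem (x i) s) (xs i)).
have yh i : y (h i) = x i by rewrite /y /= nth_index.
rewrite (partition_big h xpredT)//=; apply: eq_bigr => j _.
rewrite mulr_suml; apply: congr_big => // i.
  by apply/eqP/eqP => [<-|]; [rewrite yh|rewrite -(yh i) => /yinj].
by move=> /eqP <-; rewrite yh.
Qed.

End DimensionBounds.

(** * Open sets of measures with small upper dimension *)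

Section UpperBound.
Variables (R : realType) (d : nat) (K : set (Rd R d)).
Hypothesis cK : compact K.
Local Notation prob := (probability (BorelRd R d) R).
Implicit Types (mu nu : prob) (U V W : set prob) (r : R).

(** Near the discrete measure, almost all mass lies in disjoint balls about the atoms, in about the
    right proportions, and each ball is covered at the cost of its own packing number. The mass that
    escapes is at most |J| e2 and costs at most a multiple [d] of -log r per unit, at every scale;
    hence the neighbourhood does not depend on r. *)
Lemma open_upper_bound (I : finType) (x : I -> Rd R d) (p : I -> R)
    (rho del t e : R) :
  (forall i, K (x i)) -> (forall i, 0 < p i) -> \sum_i p i = 1 ->
  0 < rho -> 0 < del -> 0 <= t -> 0 < e ->
  (forall r, 0 < r -> r < del ->
     \sum_i p i * log_packing (K `&` eball (x i) rho) r <= t * - ln r) ->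
  exists W, [/\ weak_open K W,
    (forall mu, PK K mu -> (forall A, mass mu (A : set (BorelRd R d)) =
       \sum_(i | x i \in A) p i) -> W mu) &
    forall nu, W nu -> (upperD1 K nu <= (t + e)%:E)%E].
Proof.
move=> Kx p0 p1 rho0 del0 t0 e0 hx.
have [J [y [q [yinj yx q0 pq]]]] := merge_atoms x p0.
have q1 : \sum_j q j = 1.
  have := pq (fun=> 1); rewrite -!mulr_suml p1 !mulr1 => <-//.
have Ky j : K (y j) by have [i ->] := yx j.
have [e1 e10 he1] := separated yinj.
pose rho' := Num.min rho (e1 / 2).
have rho'0 : 0 < rho' by rewrite lt_min rho0 divr_gt0.
have rho'rho : rho' <= rho by rewrite ge_min lexx.
have rho'e1 : rho' + rho' <= e1.
  have h : rho' <= e1 / 2 by rewrite ge_min lexx orbT.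
  by lra.
have K0 : K !=set0.
  have [i _] : exists i : I, True.
    apply: contrapT => hn; move: p1; rewrite big1; first by move/eqP; rewrite eq_sym oner_eq0.
    by move=> i; case: hn; exists i.
  by exists (x i).
have bK := sub_coord_bounded cK.
have [C C0 hC] := log_packing_bound (bK K (@subset_refl _ K)) K0.
pose D : R := d%:R; pose M : R := #|J|%:R.
have D0 : 0 <= D by rewrite ler0n.
have M0 : 0 <= M by rewrite ler0n.
(* Keeps the cost of the escaping mass, about [M * e2 * D] times -log r, within [e / 2] times -log
   r. *)
pose e2 := Num.min rho' (e / 2 / (M * D + 1)).
have MD0 : 0 < M * D + 1 by rewrite ltr_wpDl// mulr_ge0.
have e20 : 0 < e2 by rewrite lt_min rho'0 !divr_gt0.
have e2rho : e2 <= rho' by rewrite ge_min lexx.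
have e2MD : M * e2 * D <= e / 2.
  have : e2 <= e / 2 / (M * D + 1) by rewrite ge_min lexx orbT.
  rewrite ler_pdivlMr// => h; apply: le_trans h; rewrite mulrDr mulr1.
  by rewrite mulrAC mulrC lerDl ltW.
have mb := @eball_measurable R d.
exists (basic_nbhd K y q e2); split; first exact: weak_open_basic.
  move=> mu muK muE; apply: discrete_basic_self => // [j|A]; first exact: ltW.
  rewrite muE big_mkcond [RHS]big_mkcond /=.
  have := pq (fun z => (z \in A)%:R); congr (_ = _); apply: eq_bigr => i _;
    by case: ifP => _; rewrite ?mulr1 ?mulr0.
move=> nu [nuK hnu].
pose A j := eball (y j) rho'.
(* [B] collects the terms that do not grow as r tends to 0; from [Lmin] on, the other half of [e]
   absorbs them. *)
pose B := (t + e / 2) * ln 4 + M * e2 * (D * C) + (M + 1).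
pose Lmin := 2 * B / e + 1.
have [|r0 [r00 r0del r01 hr0]] := @exists_small_radius R (Num.min del 1) Lmin.
  by rewrite lt_min del0 ltr01.
have {}r0del : r0 < del by move: r0del; rewrite lt_min => /andP[].
apply: (@limsup0_le _ _ _ r0) => // r rpos rr0.
have r1 : r < 1 by lra.
have ln_r : Lmin <= - ln r.
  apply: le_trans hr0 _; rewrite lerN2 ler_ln ?posrE//; exact: ltW.
have ln4 : 0 <= ln 4 :> R by rewrite ln_ge0// ler1n.
have B0 : 0 <= B.
  rewrite !addr_ge0// ?mulr_ge0//; last exact: ltW.
  by rewrite addr_ge0// divr_ge0// ltW.
have Lmin0 : 0 < Lmin.
  have : 0 <= 2 * B / e by rewrite divr_ge0 ?mulr_ge0// ltW.
  by rewrite /Lmin; lra.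
have lnr0 : 0 < - ln r by exact: lt_le_trans ln_r.
rewrite DquotE// lee_fin ler_pdivrMr//.
have r4 : 0 < r / 4 by rewrite divr_gt0.
have r41 : r / 4 < 1 by lra.
have [s0 [s0E s0K]] := packing_cover cK (@subset_refl _ K) K0 rpos r1.
have KA0 j : K `&` A j !=set0 by exists (y j); split=> //; exact: eball_center.
have /choice[s hs] : forall j, exists s : seq (Rd R d),
    ln (size s)%:R = log_packing (K `&` A j) (r / 4) /\
    forall z, (K `&` A j) z -> exists2 c, c \in s & edist c z < r / 2.
  by move=> j; apply: (packing_cover cK) => //; exact: subIsetl.
have := @entropy_upper R d K cK nu r J A s s0 nuK rpos (fun j => mb _ _) _ _ s0K.
pose L j := log_packing (K `&` A j) (r / 4).
pose L0 := log_packing K (r / 4).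
have -> : \sum_j mass nu (A j) * ln (size (s j))%:R = \sum_j mass nu (A j) * L j.
  by apply: eq_bigr => j _; have [-> _] := hs j.
rewrite s0E -/L0 -/M => hent.
have {}hent : entropy K nu r <= \sum_j mass nu (A j) * L j +
    (1 - \sum_j mass nu (A j)) * L0 + M + 1.
  apply: hent => [i j ij|j z Kz Az]; first exact/eball_disjoint/(le_trans rho'e1)/he1.
  by have [_] := hs j; apply.
have LL0 j : L j <= L0.
  by apply: log_packing_le => //; exact: bK.
have L_ge0 j : 0 <= L j.
  by apply: log_packing_ge0 => //; apply: bK.
have L00 : 0 <= L0 by apply: log_packing_ge0 => //; exact: bK.
have mass_ge j : q j - e2 <= mass nu (A j).
  apply/ltW/(lt_le_trans (hnu j))/mass_le; [exact: mb|exact: mb|].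
  by apply: le_eball; rewrite edistxx add0r.
have sumqL : \sum_j q j * L j <= t * - ln (r / 4).
  apply: le_trans (hx (r / 4) r4 _); last by lra.
  rewrite (pq (fun z => log_packing (K `&` eball z rho) (r / 4))).
  apply: ler_sum => j _; rewrite ler_pM2l//; apply: log_packing_le => //.
  - by apply: bK; exact: subIsetl.
  - by apply: setIS; apply: le_eball; rewrite edistxx add0r.
(* Since [L j <= L0], the worst case gives each ball only its guaranteed mass [q j - e2] and puts
   the remaining [M * e2] at the price [L0]. *)
have step : \sum_j mass nu (A j) * L j + (1 - \sum_j mass nu (A j)) * L0 <=
    \sum_j q j * L j + M * e2 * L0.
  have h : \sum_j (mass nu (A j) - (q j - e2)) * L j <=
      \sum_j (mass nu (A j) - (q j - e2)) * L0.
    by apply: ler_sum => j _; rewrite ler_wpM2l// subr_ge0.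
  have h' : \sum_j (q j - e2) * L j <= \sum_j q j * L j.
    by apply: ler_sum => j _; rewrite ler_wpM2r// gerBl ltW.
  move: h; rewrite -mulr_suml; under eq_bigr do rewrite mulrBl.
  rewrite !sumrB q1 sumr_const -[_ *+ _]mulr_natl -/M.
  by move: h' L00; set u := \sum_j mass _ _; nra.
have lnr4 : - ln (r / 4) = - ln r + ln 4.
  by rewrite lnM ?posrE ?invr_gt0// lnV ?posrE// opprD opprK.
have L0_le : L0 <= D * (C - ln (r / 4)) by exact: hC.
have Me2 : 0 <= M * e2 by rewrite mulr_ge0// ltW.
have hL0 : M * e2 * L0 <= M * e2 * (D * C) + e / 2 * - ln (r / 4).
  apply: le_trans (ler_wpM2l Me2 L0_le) _.
  have nl0 : 0 <= - ln (r / 4) by rewrite lnr4; lra.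
  by have := ler_wpM2r nl0 e2MD; lra.
have total : entropy K nu r <= (t + e / 2) * - ln r + B.
  by move: sumqL hL0; rewrite lnr4 /B; lra.
apply: le_trans total _.
have : B <= e / 2 * - ln r.
  have h : 2 * B / e <= - ln r by rewrite /Lmin in ln_r; lra.
  by move: h; rewrite ler_pdivrMr//; lra.
by lra.
Qed.

End UpperBound.

(** * Large entropy near packings *)

Section LowerBound.
Variables (R : realType) (d : nat) (K : set (Rd R d)).
Hypothesis cK : compact K.
Local Notation prob := (probability (BorelRd R d) R).
Implicit Types (mu nu : prob) (U V W : set prob) (r : R).

(** B(x,r) misses the balls about all the other points, which together carry at least the sum of the
    q_i - e with i different from j. What remains is at most q_j + |J| e, hence at most 2 q_j. *)
Lemma separated_mass_bound (J : finType) (y : J -> Rd R d) (q : J -> R) (e r : R) nu :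
  (forall i j, i != j -> 2 * r <= edist (y i) (y j)) -> 0 < r -> e <= r / 2 ->
  \sum_j q j = 1 -> (forall j, #|J|%:R * e <= q j) -> basic_nbhd K y q e nu ->
  forall j x, eball (y j) e x -> mass nu (eball x r) <= 2 * q j.
Proof.
move=> sep r0 er q1 eq_ [_ hnu] j x yx; have mb := @eball_measurable R d.
have mC : measurable (~` eball x r : set (BorelRd R d)) by exact/measurableC.
have e0 : 0 < e.
  by apply: le_lt_trans (edist_ge0 (y j) x) _.
have dB i i' : i != i' -> eball (y i) e `&` eball (y i') e = set0.
  by move=> /sep h; apply: eball_disjoint; lra.
have : \sum_(i | i != j) mass nu (eball (y i) e) <= mass nu (~` eball x r).
  apply: sum_mass_le => // i ij z; rewrite /eball /= => yz; apply/negP; rewrite -leNgt.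
  have := sep _ _ ij; have := edist_triangle z (y i) x.
  have := edist_triangle x (y i) (y j).
  by move: yx; rewrite /eball /= (edist_sym x (y j)) (edist_sym z x); lra.
rewrite mass_setC//.
have : \sum_(i | i != j) (q i - e) <= \sum_(i | i != j) mass nu (eball (y i) e).
  by apply: ler_sum => i _; exact: ltW.
rewrite sumrB sumr_const.
have : e *+ #|[pred i | i != j]| <= #|J|%:R * e.
  by rewrite mulr_natl; apply: ler_wpMn2l; [exact: ltW|exact: max_card].
move: q1; rewrite (bigD1 j)//=; have := eq_ j.
by move: (\sum_(i | i != j) q i) (\sum_(i | i != j) mass _ _) => u v; lra.
Qed.

Lemma conv_ubox_le_fin (E : set (Rd R d)) (I : finType) (x : I -> Rd R d)
    (p : I -> R) (rho : R) :
  (forall i, E (x i)) -> (forall i, 0 < p i) -> \sum_i p i = 1 -> 0 < rho ->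
  (conv_ubox E <= limsup0 (fun r =>
    ((\sum_i (p i)%:E * elog (packing (E `&` eball (x i) rho) r))
      * ((- ln r)^-1)%:E)%E))%E.
Proof.
move=> Ex p0 p1 rho0; apply: ereal_inf_lbound.
have reindex_enum (T : Type) (idx : T) (op : Monoid.com_law idx) (F : I -> T) :
    \big[op/idx]_i F i = \big[op/idx]_(k < #|I|) F (enum_val k).
  exact: (big_enum_val (A := I) F).
exists #|I|, (fun k => x (enum_val k)), rho, (fun k => p (enum_val k)); split=> //.
- rewrite lt0n; apply/eqP => /card0_eq I0.
  by move: p1; rewrite big1 => [/eqP|i]; [rewrite eq_sym oner_eq0|have := I0 i; rewrite inE].
- by split=> //; rewrite -p1; apply/esym/reindex_enum.
- congr limsup0; apply/funext => r; congr (_ * _)%E.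
  exact: (reindex_enum _ 0%E).
Qed.

Lemma dense_upper_entropy (y0 : Rd R d) (rho0 s t u e : R) U :
  0 < s -> u < s * t -> (t%:E < conv_ubox (K `&` eball y0 rho0))%E -> 0 < e ->
  weak_open K U -> U !=set0 -> (forall mu, U mu -> s < mass mu (eball y0 rho0)) ->
  exists W, [/\ weak_open K W, W !=set0, W `<=` U &
    forall nu, W nu -> exists r, [/\ 0 < r, r < e & (u%:E <= Dquot K nu r)%E]].
Proof.
move=> s0 ust tE e0 oU U_ne hU.
have [u0|u0] := leP u 0.
  exists U; split=> // nu Unu.
  have [r [r0 re r1 _]] := exists_small_radius 0 e0.
  by exists r; split=> //; apply: le_trans (Dquot_ge0 cK nu r0 r1); rewrite lee_fin.
have t0 : 0 < t by rewrite -(pmulr_rgt0 _ s0); exact: lt_trans ust.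
case: U_ne => mu1 Umu1.
have [I [x [p [e1 [ap e10 e1U]]]]] := exists_basic_nbhd cK oU Umu1.
have [xinj Kx p0 p1] := ap.
have p0' i : 0 <= p i by exact: ltW.
set V := eball y0 rho0; pose E := K `&` V.
pose IV := [pred i | `[< V (x i) >]].
pose P := \sum_(i in IV) p i.
have Ps : s < P.
  have [mu [muK muE]] := discrete_PK cK Kx p0' p1.
  have : s < mass mu V by apply: hU; apply: e1U; exact: discrete_basic_self.
  by rewrite muE; congr (_ < _); apply: eq_bigl => i; rewrite /IV inE.
have P0 : 0 < P by exact: lt_trans Ps.
have [e2 e20 he2] := separated xinj.
(* [e1] keeps the spread measure inside [U]; [e2 / 4] keeps the clouds of different atoms [2 * r]
   apart once [r < rho]. *)
pose rho := Num.min e1 (e2 / 4).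
have rho_gt0 : 0 < rho by rewrite lt_min e10 divr_gt0.
have rhoe1 : rho <= e1 by rewrite ge_min lexx.
have rhoe2 : 4 * rho <= e2.
  have h : rho <= e2 / 4 by rewrite ge_min lexx orbT.
  by lra.
clearbody rho.
pose k2i (k : 'I_#|IV|) : I := enum_val k.
have k2iV k : V (x (k2i k)).
  have h : `[< V (x (k2i k)) >] := enum_valP k.
  exact/asboolP.
have sumIV (F : I -> R) : \sum_k F (k2i k) = \sum_(i in IV) F i.
  by rewrite [RHS]big_enum_val.
have sumIVE (F : I -> \bar R) : (\sum_k F (k2i k) = \sum_(i in IV) F i)%E.
  by rewrite [RHS]big_enum_val.
have bE A : A `<=` K -> exists2 M : R, 0 < M & forall x, A x -> forall i, `|x ord0 i| <= M.
  exact: sub_coord_bounded.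
have := conv_ubox_le_fin (E := E) (x := fun k => x (k2i k)) (p := fun k => p (k2i k) / P)
  (rho := rho) _ _ _ _ => /(_ _ _ _ rho_gt0) hconv.
have {hconv} : (t%:E < limsup0 (fun r =>
    ((\sum_k (p (k2i k) / P)%:E * elog (packing (E `&` eball (x (k2i k)) rho) r))
      * ((- ln r)^-1)%:E)%E))%E.
  apply: lt_le_trans tE _; apply: hconv => [k|k|].
  - by split.
  - by rewrite divr_gt0.
  - by rewrite -mulr_suml (sumIV p) divff// gt_eqF.
(* The entropy bound loses at most 2: [ln 2 <= 1] for the factor 2 on the ball masses, and 1 for the
   guaranteed mass being only [q j - e3]. For -log r > M the gap between [u] and [s * t] pays for
   it. *)
pose M := 2 / (s * t - u).
have M0 : 0 < M by rewrite divr_gt0// subr_gt0.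
pose rmax := Num.min (Num.min e rho) (Num.min 1 (expR (- M))).
have rmax0 : 0 < rmax by rewrite !lt_min e0 rho_gt0 ltr01 expR_gt0.
move=> /limsup0_gt/(_ rmax0)[r [r0]].
rewrite !lt_min => /andP[/andP[re rrho] /andP[r1 rM]] tr.
have lnr : M < - ln r by exact: Nln_gt.
have lnr0 : 0 < - ln r by exact: lt_trans lnr.
pose L i := log_packing (E `&` eball (x i) rho) r.
have Eb_ne i : V (x i) -> E `&` eball (x i) rho !=set0.
  by move=> Vi; exists (x i); split; [split|exact: eball_center].
have EbK i : E `&` eball (x i) rho `<=` K by move=> z [[]].
have sumL : P * (t * - ln r) < \sum_(i in IV) p i * L i.
  move: tr; rewrite (eq_bigr (fun k => (p (k2i k) / P * L (k2i k))%:E)); last first.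
    move=> k _; rewrite EFinM.
    by have [n [_ _ _ -> _]] := packing_spec (bE _ (@EbK (k2i k))) (Eb_ne _ (k2iV k)) r0 r1.
  rewrite sumEFin -EFinM lte_fin ltr_pdivlMr//.
  rewrite (sumIV (fun i => p i / P * L i)).
  under eq_bigr do rewrite mulrAC.
  by rewrite -mulr_suml ltr_pdivlMr// mulrC.
(* Atoms outside the ball are kept as singletons, with [ln 1 = 0]. *)
have /choice[S hS] : forall i, exists S : seq (Rd R d), [/\ (0 < size S)%N,
    (forall z, z \in S -> K z /\ edist (x i) z < rho),
    (forall k l, (k < size S)%N -> (l < size S)%N -> k != l ->
       2 * r <= edist (nth 0 S k) (nth 0 S l)) &
    (i \in IV -> ln (size S)%:R = L i)].
  move=> i; case: (boolP (i \in IV)) => [iV|_]; last first.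
    exists [:: x i]; split=> // [z|k l].
      by rewrite inE => /eqP ->; rewrite edistxx.
    by rewrite !ltnS !leqn0 => /eqP -> /eqP ->.
  have Vi : V (x i) by apply/asboolP; exact: iV.
  have [n [n0 _ lE _ [z [Ez sepz _]]]] :=
    packing_spec (bE _ (@EbK i)) (Eb_ne _ Vi) r0 r1.
  exists (codom z); rewrite size_codom card_ord; split=> //.
    by move=> w /codomP[k ->]; have [[? _] ?] := Ez k; split.
  move=> k l kn ln kl; have := sepz (Ordinal kn) (Ordinal ln).
  rewrite /codom !(nth_map (Ordinal kn)) -?enumT ?size_enum_ord//.
  by rewrite (nth_ord_enum _ (Ordinal kn)) (nth_ord_enum _ (Ordinal ln)); apply.
pose J : finType := {i : I & 'I_(size (S i))}.
pose y (j : J) := nth 0 (S (tag j)) (tagged j).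
pose N i : R := (size (S i))%:R.
have N0 i : 0 < N i by rewrite ltr0n; have [] := hS i.
have lnN i : 0 <= ln (N i) by rewrite ln_ge0// ler1n; have [] := hS i.
pose q (j : J) := p (tag j) / N (tag j).
have q0 j : 0 < q j by rewrite divr_gt0.
have sumJ (F : I -> R) : \sum_(j : J) F (tag j) = \sum_i N i * F i.
  rewrite -(@sig_big_dep _ _ _ I (fun i => 'I_(size (S i))) xpredT (fun _ => xpredT)
    (fun i _ => F i)) /=; apply: eq_bigr => i _.
  by rewrite sumr_const card_ord mulr_natl.
have q1 : \sum_j q j = 1.
  rewrite (sumJ (fun i => p i / N i)) -p1; apply: eq_bigr => i _.
  by rewrite mulrC divfK// gt_eqF.
have yS j : y j \in S (tag j) by exact: mem_nth.
have Ky j : K (y j) by have [_ /(_ _ (yS j))[]] := hS (tag j).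
have yx j : edist (x (tag j)) (y j) < rho by have [_ /(_ _ (yS j))[]] := hS (tag j).
have sep i j : i != j -> 2 * r <= edist (y i) (y j).
  have [] := eqVneq (tag i) (tag j).
    case: i => i k; case: j => j l /= ij; case: j / ij l => l kl.
    have [_ _ h _] := hS i; apply: h => //.
    by apply: contraNneq kl => kl; rewrite (val_inj kl : k = l).
  move=> ij _; have := he2 _ _ ij; have := yx i; have := yx j.
  have := edist_triangle (y i) (x (tag i)) (x (tag j)).
  have := edist_triangle (y j) (y i) (x (tag j)).
  by rewrite (edist_sym (y j)); lra.
have yinj : injective y.
  move=> i j yij; apply/eqP; apply: contraT => /sep; rewrite yij edistxx; lra.
have aq : atoms K y q by split.
have [qmin qmin0 hqmin] := fin_pos_lower_bound q0.
pose Lsum := \sum_(j : J) ln (N (tag j)).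
have Lsum0 : 0 <= Lsum by apply: sumr_ge0 => j _.
pose NJ : R := #|J|%:R; have NJ0 : 0 <= NJ by rewrite ler0n.
(* The first two terms are the hypotheses of [separated_mass_bound]; the last bounds the loss
   [e3 * Lsum] by 1. *)
pose e3 := Num.min (r / 2) (Num.min (qmin / (NJ + 1)) (Lsum + 1)^-1).
have NJ1 : 0 < NJ + 1 by lra.
have Lsum1 : 0 < Lsum + 1 by lra.
have e30 : 0 < e3.
  rewrite lt_min divr_gt0//= lt_min divr_gt0//=; by rewrite invr_gt0.
have e3r : e3 <= r / 2 by rewrite ge_min lexx.
have e3q j : NJ * e3 <= q j.
  apply: le_trans (hqmin j); have : e3 <= qmin / (NJ + 1) by rewrite !ge_min lexx !orbT.
  by rewrite ler_pdivlMr// mulrDr mulr1 mulrC; lra.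
have e3L : e3 * Lsum <= 1.
  have : e3 <= (Lsum + 1)^-1 by rewrite !ge_min lexx !orbT.
  by rewrite -[leRHS]div1r ler_pdivlMr// mulrDr mulr1; lra.
exists (U `&` basic_nbhd K y q e3); split.
- by apply: weak_openI => //; exact: weak_open_basic.
- have q0' j : 0 <= q j by exact: ltW.
  have [mu [muK muE]] := discrete_PK cK Ky q0' q1.
  exists mu; split; last exact: discrete_basic_self.
  apply: e1U; apply: (discrete_basic muK q0' muE) => i.
  exists (fun j => tag j == i) => [j /eqP <-|]; first exact: lt_le_trans (yx j) rhoe1.
  have -> : \sum_(j : J | tag j == i) q j = p i; last by lra.
  rewrite big_mkcond (eq_bigr (fun j : J => if tag j == i then p i / N i else 0)).
    rewrite (sumJ (fun k => if k == i then p i / N i else 0)) (bigD1 i)//= eqxx.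
    rewrite big1 ?addr0 => [|k /negbTE ->]; last by rewrite mulr0.
    by rewrite mulrC divfK// gt_eqF.
  by move=> j _; case: eqP => // <-.
- exact: subIsetl.
move=> nu [Unu hnu]; exists r; split=> //.
have [nuK nu_gt] := hnu.
rewrite DquotE// lee_fin ler_pdivlMr//.
have mb := @eball_measurable R d.
have dB i j : i != j -> eball (y i) e3 `&` eball (y j) e3 = set0.
  by move=> /sep h; apply: eball_disjoint; lra.
have := @entropy_lower R d K cK nu r J (fun j => eball (y j) e3) (fun j => 2 * q j)
  nuK r0 (fun j => mb _ _) dB _ _.
have sumB : \sum_j mass nu (eball (y j) e3) <= 1.
  by rewrite sum_mass// mass_le1//; exact: bigsetU_measurable.
have ln2_le1 : ln 2 <= 1 :> R.
  by rewrite -[X in ln X]/(1 + 1) le_ln1Dx//; lra.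
have p_le1 i : p i <= 1 by rewrite -p1 (bigD1 i)//= lerDl sumr_ge0.
have loss j : ln (N (tag j)) - 1 <= - ln (2 * q j).
  rewrite lnM ?posrE//.
  have -> : ln (q j) = ln (p (tag j)) - ln (N (tag j)).
    by rewrite /q lnM ?posrE ?invr_gt0// lnV ?posrE.
  by have := ln_le0 (p_le1 (tag j)); lra.
move=> h; apply: le_trans (h _ _) => {h}; last first.
- move=> j z yz; exact: separated_mass_bound sep r0 e3r q1 e3q hnu _ _ yz.
- by move=> j; rewrite mulr_gt0.
apply: (@le_trans _ _ (\sum_j mass nu (eball (y j) e3) * (ln (N (tag j)) - 1))); last first.
  by apply: ler_sum => j _; rewrite ler_wpM2l// mass_ge0.
apply: (@le_trans _ _ (\sum_j (q j - e3) * ln (N (tag j)) - 1)); last first.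
  under [leRHS]eq_bigr do rewrite mulrBr mulr1.
  rewrite sumrB lerB//; apply: ler_sum => j _; rewrite ler_wpM2r//.
  exact: ltW.
have -> : \sum_j (q j - e3) * ln (N (tag j)) = \sum_i p i * ln (N i) - e3 * Lsum.
  under eq_bigr do rewrite mulrBl.
  rewrite sumrB -mulr_sumr; congr (_ - _).
  rewrite (sumJ (fun i => p i / N i * ln (N i))); apply: eq_bigr => i _.
  by rewrite mulrA [N i * _]mulrC divfK// gt_eqF.
have sumN : \sum_(i in IV) p i * L i <= \sum_i p i * ln (N i).
  rewrite [leRHS](bigID (mem IV)) /= -[leLHS]addr0 lerD//; last first.
    by apply: sumr_ge0 => i _; rewrite mulr_ge0.
  by apply: ler_sum => i iV; have [_ _ _ ->] := hS i.
have tr0 : 0 <= t * - ln r by rewrite mulr_ge0// ltW.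
have Pst : s * (t * - ln r) <= P * (t * - ln r) by rewrite ler_wpM2r// ltW.
have Mst : 2 <= (s * t - u) * - ln r.
  by move: lnr; rewrite /M ltr_pdivrMr ?subr_gt0// mulrC => /ltW.
by lra.
Qed.

End LowerBound.

(** * Typical dimensions and optimality of the interval *)

Section Dimensions.
Variables (R : realType) (d : nat) (K : set (Rd R d)).
Hypothesis cK : compact K.
Local Notation prob := (probability (BorelRd R d) R).
Implicit Types (mu nu : prob) (U V W : set prob) (r : R).

Lemma conv_quotientE (E : set (Rd R d)) (I : finType) (x : I -> Rd R d)
    (p : I -> R) (rho r : R) :
  E `<=` K -> (forall i, E (x i)) -> 0 < rho -> 0 < r -> r < 1 ->
  ((\sum_i (p i)%:E * elog (packing (E `&` eball (x i) rho) r))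
      * ((- ln r)^-1)%:E)%E =
  ((\sum_i p i * log_packing (E `&` eball (x i) rho) r) / - ln r)%:E.
Proof.
move=> EK Ex rho0 r0 r1; rewrite EFinM; congr (_ * _)%E.
rewrite -sumEFin; apply: eq_bigr => i _; rewrite EFinM; congr (_ * _)%E.
have bE : exists2 M : R, 0 < M &
    forall z, (E `&` eball (x i) rho) z -> forall c, `|z ord0 c| <= M.
  by apply: (sub_coord_bounded cK) => z [/EK].
have E0 : E `&` eball (x i) rho !=set0.
  by exists (x i); split=> //; exact: eball_center.
by have [n [_ _ _ -> _]] := packing_spec bE E0 r0 r1.
Qed.

Lemma conv_limsup_ge0 (E : set (Rd R d)) (I : finType) (x : I -> Rd R d)
    (p : I -> R) (rho : R) :
  E `<=` K -> (forall i, E (x i)) -> (forall i, 0 < p i) -> 0 < rho ->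
  (0 <= limsup0 (fun r => ((\sum_i (p i)%:E *
     elog (packing (E `&` eball (x i) rho) r)) * ((- ln r)^-1)%:E)%E))%E.
Proof.
move=> EK Ex p0 rho0; apply: limsup0_ge => e e0.
have [r [r0 re r1 _]] := exists_small_radius 0 e0.
exists r; split=> //; rewrite conv_quotientE// lee_fin divr_ge0//; last first.
  by rewrite oppr_ge0 ln_le0// ltW.
apply: sumr_ge0 => i _; apply: mulr_ge0; first exact: ltW.
apply: log_packing_ge0 => //.
  by apply: (sub_coord_bounded cK) => z [/EK].
by exists (x i); split=> //; exact: eball_center.
Qed.

Lemma conv_ubox_ge0 (E : set (Rd R d)) : E `<=` K -> (0 <= conv_ubox E)%E.
Proof.
move=> EK; apply: le_ereal_inf_tmp => _ [N [x [rho [p [_ Ex rho0 [p0 _] ->]]]]].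
exact: conv_limsup_ge0.
Qed.

Lemma conv_ubox_max_ge0 : K !=set0 -> (0 <= conv_ubox_max K)%E.
Proof.
move=> [y Ky]; apply: (@le_trans _ _ (conv_ubox (K `&` eball y 1))).
  by apply: conv_ubox_ge0; exact: subIsetl.
by apply: ereal_sup_ubound; exists y, 1.
Qed.

Lemma upperD1_ge0 mu : (0 <= upperD1 K mu)%E.
Proof.
apply: limsup0_ge => e e0; have [r [r0 re r1 _]] := exists_small_radius 0 e0.
by exists r; split=> //; exact: Dquot_ge0.
Qed.

Lemma conv_ubox_lt_witness (E : set (Rd R d)) (t : R) : E `<=` K ->
  (conv_ubox E < t%:E)%E ->
  exists (N : nat) (x : 'I_N -> Rd R d) (p : 'I_N -> R) (rho del : R),
    [/\ (forall i, E (x i)), (forall i, 0 < p i), \sum_i p i = 1, 0 < rho & 0 < del] /\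
    forall r, 0 < r -> r < del ->
      \sum_i p i * log_packing (E `&` eball (x i) rho) r <= t * - ln r.
Proof.
move=> EK /ereal_inf_lt[_ [N [x [rho [p [_ Ex rho0 [p0 p1] ->]]]]]].
move=> /limsup0_lt[del del0 h].
exists N, x, p, rho, (Num.min del 1); split; first by split=> //; rewrite lt_min del0 ltr01.
move=> r r0; rewrite lt_min => /andP[rdel r1].
have := h r r0 rdel; rewrite conv_quotientE// lte_fin ltr_pdivrMr ?oppr_gt0 ?ln_lt0 ?r0//.
exact: ltW.
Qed.

(** Each atom x_i of a discrete measure in [U] is replaced by a family in K ∩ B(x_i,e1) nearly
    optimal for the convex dimension there, which is at most [conv_ubox_max K]. The product weights
    keep the new measure in [U], and [open_upper_bound] applies to it. *)
Lemma dense_upper_bound U (e : R) : weak_open K U -> U !=set0 -> 0 < e ->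
  exists W, [/\ weak_open K W, W !=set0, W `<=` U &
    forall nu, W nu -> (upperD1 K nu <= conv_ubox_max K + e%:E)%E].
Proof.
move=> oU U_ne e0; have [mu1 Umu1] := U_ne.
have [I [x [p [e1 [ap e10 e1U]]]]] := exists_basic_nbhd cK oU Umu1.
have [xinj Kx p0 p1] := ap.
have p0' i : 0 <= p i by exact: ltW.
have K0 : K !=set0.
  have [i _] : exists i : I, True.
    apply: contrapT => hn; move: p1; rewrite big1; first by move/eqP; rewrite eq_sym oner_eq0.
    by move=> i; case: hn; exists i.
  by exists (x i).
have [mE|[m mE]] : conv_ubox_max K = +oo%E \/ exists m, conv_ubox_max K = m%:E.
  by case: (conv_ubox_max K) (conv_ubox_max_ge0 K0) => [m| |] //= _; [right; exists m|left].
  by exists U; split=> // nu _; rewrite mE addye// leey.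
have m0 : 0 <= m by rewrite -lee_fin -mE conv_ubox_max_ge0.
pose t := m + e / 2.
have t0 : 0 <= t by rewrite addr_ge0// divr_ge0// ltW.
have EK i : K `&` eball (x i) e1 `<=` K by exact: subIsetl.
have conv_lt i : (conv_ubox (K `&` eball (x i) e1) < t%:E)%E.
  apply: (@le_lt_trans _ _ m%:E); last by rewrite lte_fin ltrDl divr_gt0.
  by rewrite -mE; apply: ereal_sup_ubound; exists (x i), e1.
(* The families have different sizes; a dependent pair gathers all the data so that one choice
   function selects them. *)
pose wit i (w : {N : nat & ((('I_N -> Rd R d) * ('I_N -> R)) * (R * R))%type}) :=
  let: existT N ((z, q), (rho, del)) := w in
  [/\ (forall k, (K `&` eball (x i) e1) (z k)), (forall k, 0 < q k), \sum_k q k = 1,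
     0 < rho & 0 < del] /\ forall r, 0 < r -> r < del ->
    \sum_k q k * log_packing (K `&` eball (x i) e1 `&` eball (z k) rho) r <= t * - ln r.
have /choice[w hw] : forall i, exists w, wit i w.
  move=> i; have [N [z [q [rho [del h]]]]] := conv_ubox_lt_witness (EK i) (conv_lt i).
  by exists (existT _ N ((z, q), (rho, del))).
pose N i := projT1 (w i).
pose z i : 'I_(N i) -> Rd R d := (projT2 (w i)).1.1.
pose q i : 'I_(N i) -> R := (projT2 (w i)).1.2.
pose rho i := (projT2 (w i)).2.1.
pose del i := (projT2 (w i)).2.2.
have {}hw i : [/\ (forall k, (K `&` eball (x i) e1) (@z i k)), (forall k, 0 < @q i k),
     \sum_k @q i k = 1, 0 < rho i & 0 < del i] /\ forall r, 0 < r -> r < del i ->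
    \sum_k @q i k * log_packing (K `&` eball (x i) e1 `&` eball (@z i k) (rho i)) r
      <= t * - ln r.
  by have := hw i; rewrite /wit /z /q /rho /del /N; case: (w i) => N' [[z' q'] [rho' del']].
clearbody N z q rho del.
pose J : finType := {i : I & 'I_(N i)}.
pose zJ (j : J) := z (tag j) (tagged j).
pose qJ (j : J) := p (tag j) * q (tag j) (tagged j).
have z_in i k : (K `&` eball (x i) e1) (z i k) by have [[]] := hw i.
have q0 i k : 0 < q i k by have [[]] := hw i.
have sum_q i : \sum_k q i k = 1 by have [[]] := hw i.
have rho0 i : 0 < rho i by have [[]] := hw i.
have del0 i : 0 < del i by have [[]] := hw i.
have KzJ j : K (zJ j) by have [] := z_in (tag j) (tagged j).
have qJ0 j : 0 < qJ j by rewrite mulr_gt0.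
have sumJ (F : forall i, 'I_(N i) -> R) :
    \sum_(j : J) F (tag j) (tagged j) = \sum_i \sum_k F i k.
  by rewrite (@sig_big_dep _ _ _ I (fun i => 'I_(N i)) xpredT (fun _ => xpredT) F).
have sum_pq i : \sum_k p i * q i k = p i by rewrite -mulr_sumr sum_q mulr1.
have sum_qJ : \sum_j qJ j = 1.
  by rewrite (sumJ (fun i k => p i * q i k)) -p1; apply: eq_bigr.
(* With this radius the ball about a new point lies in B(x_i,e1) and in its own B(z,rho), so
   packings of [K] in it are bounded by the local packing numbers. *)
have [|rho2 rho20 hrho] := @fin_pos_lower_bound R J
  (fun j => Num.min (rho (tag j)) (e1 - edist (x (tag j)) (zJ j))).
  move=> j; rewrite lt_min rho0 subr_gt0.
  by have [] := z_in (tag j) (tagged j).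
have [del1 del10 hdel] := fin_pos_lower_bound del0.
have bE i k (c : R) : exists2 M : R, 0 < M & forall u,
    (K `&` eball (x i) e1 `&` eball (z i k) c) u -> forall l, `|u ord0 l| <= M.
  by apply: (sub_coord_bounded cK) => u [[]].
have [W [oW Wdisc Wub]] : exists W, [/\ weak_open K W,
    (forall mu, PK K mu -> (forall A, mass mu (A : set (BorelRd R d)) =
       \sum_(j | zJ j \in A) qJ j) -> W mu) &
    forall nu, W nu -> (upperD1 K nu <= (t + e / 2)%:E)%E].
  apply: (@open_upper_bound R d K cK J zJ qJ rho2 (Num.min del1 1)) => //.
  - by rewrite lt_min del10 ltr01.
  - by rewrite divr_gt0.
  move=> r r0; rewrite lt_min => /andP[rdel r1].
  have lnr0 : 0 <= - ln r by rewrite oppr_ge0 ln_le0// ltW.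
  apply: (@le_trans _ _ (\sum_i p i * (t * - ln r))); last by rewrite -mulr_suml p1 mul1r.
  apply: (@le_trans _ _ (\sum_i p i * \sum_k q i k *
      log_packing (K `&` eball (x i) e1 `&` eball (z i k) (rho i)) r)); last first.
    apply: ler_sum => i _; rewrite ler_pM2l//; have [_ h] := hw i; apply: h => //.
    exact: lt_le_trans (hdel i).
  under [leRHS]eq_bigr do rewrite mulr_sumr.
  rewrite -(sumJ (fun i k => p i * (q i k *
    log_packing (K `&` eball (x i) e1 `&` eball (z i k) (rho i)) r))).
  apply: ler_sum => j _; rewrite /qJ -mulrA !ler_pM2l//.
  have := hrho j; rewrite le_min => /andP[rho_le e1_le].
  apply: log_packing_le => //.
  - move=> u [Ku zu]; split; last by apply: (le_eball _ zu); rewrite edistxx add0r.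
    split=> //; apply: (le_eball _ zu); rewrite -/(zJ j).
    by move: e1_le; rewrite lerBrDr addrC.
  - by exists (zJ j); split=> //; exact: eball_center.
exists (W `&` U); split.
- exact: weak_openI.
- have qJ0' j : 0 <= qJ j by exact: ltW.
  have [mu [muK muE]] := discrete_PK cK KzJ qJ0' sum_qJ.
  exists mu; split; first exact: Wdisc.
  apply: e1U; apply: (discrete_basic muK qJ0' muE) => i.
  exists (fun j => tag j == i) => [j /eqP <-|].
    by have [] := z_in (tag j) (tagged j).
  have -> : \sum_(j : J | tag j == i) qJ j = p i; last by lra.
  rewrite big_mkcond /=.
  rewrite (sumJ (fun i' k => if i' == i then p i' * q i' k else 0)).
  rewrite (bigD1 i)//= eqxx sum_pq big1 ?addr0// => i' /negbTE ->.
  by rewrite big1.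
- by move=> nu [].
- move=> nu [/Wub + _]; rewrite mE -EFinD (_ : t + e / 2 = m + e)//.
  by rewrite /t -addrA -splitr.
Qed.

(** The room between [b] and [c], which may be +oo, is shared between a mass [s] below 1 and a
    dimension [t] below [c]. *)
Lemma conv_factor (b c : \bar R) : (0 <= b)%E -> (b < c)%E ->
  exists b' s t : R, [/\ b = b'%:E, 0 < s, s < 1, b' < s * t & (t%:E < c)%E].
Proof.
move=> b0 bc; have [b' bE] : exists b', b = b'%:E.
  by case: b b0 bc => [b' _ _|_|//]; [exists b'|rewrite ltNge leey].
move: b0 bc; rewrite bE lee_fin => b0 bc.
have [t [bt tc]] : exists t : R, b' < t /\ (t%:E < c)%E.
  case: c bc => [c| |] //= bc.
    by rewrite lte_fin in bc; exists ((b' + c) / 2); rewrite lte_fin; split; lra.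
  by exists (b' + 1); rewrite ltry; split=> //; lra.
have t0 : 0 < t by exact: le_lt_trans bt.
exists b', ((b' + t) / 2 / t), t; split=> //.
- by rewrite !divr_gt0//; lra.
- by rewrite ltr_pdivrMr//; lra.
- by rewrite divfK ?gt_eqF//; lra.
Qed.

Lemma upperD1_ge mu (c : R) :
  (forall e : R, 0 < e -> exists r, [/\ 0 < r, r < e & (c%:E <= Dquot K mu r)%E]) ->
  (c%:E <= upperD1 K mu)%E.
Proof. exact: limsup0_ge. Qed.

Lemma exists_natSinv_lt (e : R) : 0 < e -> exists n : nat, n.+1%:R^-1 < e.
Proof.
by move=> e0; have [n _ /(_ n (leqnn n))] := near_infty_natSinv_lt (PosNum e0); exists n.
Qed.

Lemma compact_sub_eball y : K y -> exists2 rho : R, 0 < rho & K `<=` eball y rho.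
Proof.
move=> Ky; have [M M0 hM] := compact_coord_bounded cK.
have dM0 : 0 <= d%:R * (2 * M) by rewrite !mulr_ge0// ltW.
exists (d%:R * (2 * M) + 1); first by lra.
move=> x Kx; rewrite /eball /=; apply: (@le_lt_trans _ _ (d%:R * (2 * M))); last by lra.
apply: edist_le_coord => [|i]; first by rewrite mulr_ge0// ltW.
have := hM _ Kx i; have := hM _ Ky i; rewrite !ler_norml.
by move=> /andP[? ?] /andP[? ?]; apply/andP; split; lra.
Qed.

(** Apply [dense_upper_entropy] to a ball containing [K]: every measure gives it mass 1, more than
    any [s < 1]. *)
Lemma dense_upper_entropy_K U (t e : R) : K !=set0 -> (t%:E < conv_ubox K)%E -> 0 < e ->
  weak_open K U -> U !=set0 ->
  exists W, [/\ weak_open K W, W !=set0, W `<=` U &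
    forall nu, W nu -> exists r, [/\ 0 < r, r < e & (t%:E <= Dquot K nu r)%E]].
Proof.
move=> [y Ky] tc e0 oU U0; have [t0|t0] := leP 0 t; last first.
  exists U; split=> // nu _.
  have [r [r0 re r1 _]] := exists_small_radius 0 e0; exists r; split=> //.
  by apply: le_trans (Dquot_ge0 cK nu r0 r1); rewrite lee_fin ltW.
have [rho rho0 Krho] := compact_sub_eball Ky.
have KE : K `&` eball y rho = K by apply/setIidPl.
have [|b' [s [t' [[<-] s0 s1 ts t'c]]]] := conv_factor _ tc.
  by rewrite lee_fin.
have tE : (t'%:E < conv_ubox (K `&` eball y rho))%E by rewrite KE.
apply: (dense_upper_entropy cK s0 ts tE e0 oU U0).
move=> mu /(weak_open_sub oU) muK; apply: lt_le_trans s1 _.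
have <- : mass mu K = 1 by rewrite /mass muK.
by apply: mass_le => //; [exact: measK|exact: eball_measurable].
Qed.

Lemma typical_dimension : K !=set0 ->
  typical K (fun mu => lowerD1 K mu = 0%E /\
      (conv_ubox K <= upperD1 K mu <= conv_ubox_max K)%E).
Proof.
move=> K0; pose c := conv_ubox K.
have c0 : (0 <= c)%E by exact: conv_ubox_ge0.
(* Reals increasing to [c] from strictly below, whether [c] is finite or not. *)
have [t [tc t_mono t_cvg]] : exists t : nat -> R, [/\ (forall n, ((t n)%:E < c)%E),
    (forall m n, (m <= n)%N -> t m <= t n) &
    forall a : \bar R, (forall n, ((t n)%:E <= a)%E) -> (c <= a)%E].
  case: c c0 => [c| |//] _.
    exists (fun n => c - n.+1%:R^-1); split=> [n|m n mn|a h].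
    - by rewrite lte_fin gtrDl oppr_lt0 invr_gt0.
    - by rewrite lerD2l lerN2 lef_pV2 ?posrE ?ltr0n// ler_nat ltnS.
    - apply/lee_subgt0Pr => e e0; have [n hn] := exists_natSinv_lt e0.
      by apply: le_trans (h n); rewrite -EFinB lee_fin lerD2l lerN2 ltW.
  exists (fun n => n%:R); split=> [n|m n mn|a h]; first exact: ltry.
    by rewrite ler_nat.
  rewrite leye_eq; apply/eqP/eqyP => A A0; apply: le_trans (h (Num.bound A)).
  by rewrite lee_fin ltW// archi_boundP// ltW.
pose Q n : set prob := [set mu |
  [/\ exists r, [/\ 0 < r, r < n.+1%:R^-1 & (Dquot K mu r <= (n.+1%:R^-1)%:E)%E],
      exists r, [/\ 0 < r, r < n.+1%:R^-1 & ((t n)%:E <= Dquot K mu r)%E] &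
      (upperD1 K mu <= conv_ubox_max K + (n.+1%:R^-1)%:E)%E]].
have hQ n U : weak_open K U -> U !=set0 ->
    exists W, [/\ weak_open K W, W !=set0, W `<=` U & W `<=` Q n].
  move=> oU U0; have n0 : 0 < n.+1%:R^-1 :> R by rewrite invr_gt0.
  have [W1 [oW1 W10 W1U h1]] := dense_lower_entropy cK oU U0 n0.
  have [W2 [oW2 W20 W21 h2]] := dense_upper_entropy_K K0 (tc n) n0 oW1 W10.
  have [W3 [oW3 W30 W32 h3]] := dense_upper_bound oW2 W20 n0.
  exists W3; split=> //; first by move=> nu /W32/W21/W1U.
  by move=> nu W3nu; split; [apply/h1/W21/W32|apply/h2/W32|apply/h3].
have [G [oG [dG GQ]]] := typical_forall cK hQ.
exists G; split=> //; split=> // mu /GQ{}GQ.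
have mu_small (P : nat -> R -> Prop) : (forall n, exists r, [/\ 0 < r, r < n.+1%:R^-1 & P n r]) ->
    forall e : R, 0 < e -> exists n r, [/\ n.+1%:R^-1 < e, 0 < r, r < e & P n r].
  move=> h e e0; have [n hn] := exists_natSinv_lt e0; have [r [r0 rn Pr]] := h n.
  by exists n, r; split=> //; exact: lt_trans hn.
split.
  apply: liminf0_eq0 => [r|e e0]; first exact: Dquot_ge0.
  have [|n [r [ne r0 re hr]]] := mu_small (fun n r => (Dquot K mu r <= (n.+1%:R^-1)%:E)%E) _ e e0.
    by move=> n; have [] := GQ n.
  by exists r; split=> //; apply: le_trans hr _; rewrite lee_fin ltW.
apply/andP; split; last first.
  apply/lee_addgt0Pr => e e0; have [n hn] := exists_natSinv_lt e0.
  have [_ _ h] := GQ n; apply: le_trans h _.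
  by apply: leeD2l; rewrite lee_fin ltW.
apply: t_cvg => u; apply: upperD1_ge => e e0; have [n0 hn0] := exists_natSinv_lt e0.
(* [n0] makes the radius smaller than [e], and [u] ensures the value is at least [t u]. *)
pose n := maxn u n0; have [_ [r [r0 rn hr]] _] := GQ n.
exists r; split=> //.
  apply: lt_trans rn _; apply: le_lt_trans hn0.
  by rewrite lef_pV2 ?posrE ?ltr0n// ler_nat ltnS leq_maxr.
by apply: le_trans hr; rewrite lee_fin t_mono// leq_maxl.
Qed.

(** Otherwise some family of points has growth rate t < a, and [open_upper_bound] gives a nonempty
    open set on which [upperD1] is at most (a + t)/2 < a; a dense set of measures meets it. *)
Lemma typical_lower_end (a b : R) :
  typical K (fun mu => (a%:E <= upperD1 K mu <= b%:E)%E) -> (a%:E <= conv_ubox K)%E.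
Proof.
move=> [G [oG [dG GQ]]]; rewrite leNgt; apply/negP => ca.
have [t [t0 ct ta]] : exists t : R, [/\ 0 <= t, (conv_ubox K < t%:E)%E & t < a].
  have := conv_ubox_ge0 (@subset_refl _ K); move: ca.
  case: (conv_ubox K) => [c| |] //; rewrite lte_fin lee_fin => ca c0.
  by exists ((c + a) / 2); rewrite lte_fin; split; lra.
have [N [x [p [rho [del [[Kx p0 p1 rho0 del0] h]]]]]] :=
  conv_ubox_lt_witness (@subset_refl _ K) ct.
have e0 : 0 < (a - t) / 2 by rewrite divr_gt0// subr_gt0.
have [W [oW Wdisc Wub]] := open_upper_bound cK Kx p0 p1 rho0 del0 t0 e0 h.
have p0' i : 0 <= p i by exact: ltW.
have [mu [muK muE]] := discrete_PK cK Kx p0' p1.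
have [_ dense] := dG.
have [|nu [Gnu Wnu]] := dense W oW; first by exists mu; exact: Wdisc.
have /andP[anu _] := GQ _ Gnu.
have := le_trans anu (Wub _ Wnu); rewrite lee_fin; lra.
Qed.

(** If b < [conv_ubox (K ∩ B(y,rho))], consider the open set [U0] of measures giving B(y,rho) mass
    more than s; it contains delta_y. Below [U0], quotients at least u > b at arbitrarily small
    scales occur densely, so [typical_meets] yields a measure with [upperD1] both at most b and at
    least u. *)
Lemma typical_upper_end (a b : R) : K !=set0 ->
  typical K (fun mu => (a%:E <= upperD1 K mu <= b%:E)%E) -> (conv_ubox_max K <= b%:E)%E.
Proof.
move=> [z Kz] [G [oG [dG GQ]]].
have discrete1 y : K y -> exists mu, PK K mu /\
    forall A, y \in A -> mass mu (A : set (BorelRd R d)) = 1.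
  move=> Ky; have [||mu [muK muE]] := @discrete_PK R d K cK unit (fun=> y) (fun=> 1) (fun=> Ky).
  - by [].
  - by rewrite big_const card_unit /= addr0.
  exists mu; split=> // A yA; rewrite muE big_mkcond /= yA.
  by rewrite big_const card_unit /= addr0.
have b0 : 0 <= b.
  have [mu [muK _]] := discrete1 z Kz; have [_ dense] := dG.
  have [|nu [Gnu _]] := dense (PK K) (weak_openT K); first by exists mu.
  have /andP[_ nub] := GQ _ Gnu.
  by rewrite -lee_fin; exact: le_trans (upperD1_ge0 nu) nub.
apply: ge_ereal_sup => _ [y [rho [Ky rho0 ->]]].
rewrite leNgt; apply/negP => bc.
have [|b' [s [t [[<-] s0 s1 bst tc]]]] := conv_factor _ bc; first by rewrite lee_fin.
pose u := (b + s * t) / 2.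
have ust : u < s * t by rewrite /u; lra.
have bu : b < u by rewrite /u; lra.
pose Q n : set prob := [set mu |
  exists r, [/\ 0 < r, r < n.+1%:R^-1 & (u%:E <= Dquot K mu r)%E]].
pose U0 : set prob := [set mu | PK K mu /\ s < mass mu (eball y rho)].
have [|||mu [_ /andP[_ mub] hmu]] :=
    @typical_meets R d K cK (fun mu => (a%:E <= upperD1 K mu <= b%:E)%E) G U0 oG dG GQ Q.
- exact: weak_open_mass_eball.
- have [mu [muK muE]] := discrete1 y Ky; exists mu; split=> //.
  by rewrite muE//; apply/mem_set; exact: eball_center.
- move=> n U oU U_ne UU0; have n0 : 0 < n.+1%:R^-1 :> R by rewrite invr_gt0.
  apply: (dense_upper_entropy cK s0 ust tc n0 oU U_ne).
  by move=> mu /UU0[].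
have uD : (u%:E <= upperD1 K mu)%E.
  apply: upperD1_ge => e e0; have [n hn] := exists_natSinv_lt e0.
  by have [r [r0 rn hr]] := hmu n; exists r; split=> //; exact: lt_trans hn.
by have := le_trans uD mub; rewrite lee_fin; lra.
Qed.

End Dimensions.

Theorem theorem1p2 (R : realType) (d : nat) (K : set (Rd R d)) :
  compact K -> infinite_set K ->
  typical K (fun mu => lowerD1 K mu = 0%E /\
      (conv_ubox K <= upperD1 K mu <= conv_ubox_max K)%E) /\
  (forall a b : R, typical K (fun mu => (a%:E <= upperD1 K mu <= b%:E)%E) ->
      (a%:E <= conv_ubox K)%E /\ (conv_ubox_max K <= b%:E)%E).
Proof.
move=> cK /infinite_setN0 K0; split; first exact: typical_dimension.
move=> a b hab; split; first exact: typical_lower_end hab.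
exact: typical_upper_end hab.
Qed.
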